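(* Let $x_0>1$ be the real root of $x^3=x^2+x+1$ and let $\delta=\log_2(x_0)$. There are constants $c,C>0$ and non-trivial words $W_n\in F_2=\langle a,b\rangle$ ($n\ge 0$) such that, for every $n$, $$|W_n|\le C\,2^n,$$ and, for every $n$ and every pair of rotations $A,B\in \mathrm{SO}(3)$, $$\|W_n(A,B)-I\|\le \exp\!\left(-c\,|W_n|^{\delta}\right).$$ Consequently, if $L_{\mathrm{SO}(3)}(\varepsilon)$ denotes the least length of an $\varepsilon$-almost law for $\mathrm{SO}(3)$, then $$L_{\mathrm{SO}(3)}(\varepsilon)\ll \bigl(\log(1/\varepsilon)\bigr)^{1/\delta}\qquad(\varepsilon\to 0),$$ i.e. there are constants $C'>0$ and $\varepsilon_0\in(0,1)$ such that $L_{\mathrm{SO}(3)}(\varepsilon)\le C'(\log(1/\varepsilon))^{1/\delta}$ for all $0<\varepsilon\le\varepsilon_0$.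
   Context: $F_2=\langle a,b\rangle$ is the free group on two generators; $|w|$ is the reduced word length of $w\in F_2$ with respect to $a^{\pm1},b^{\pm1}$; $w$ is non-trivial if $w\neq 1$ in $F_2$. For a group $G$ and $g,h\in G$, $w(g,h)$ is the image of $w$ under the homomorphism $F_2\to G$ with $a\mapsto g$, $b\mapsto h$. $\mathrm{SO}(3)$ carries the operator-norm metric inherited from $M_3(\mathbb R)$, i.e. the distance from $A$ to $B$ is $\|A-B\|$ with $\|\cdot\|$ the operator norm for the Euclidean norm on $\mathbb R^3$. A non-trivial word $w\in F_2$ is an $\varepsilon$-almost law for $\mathrm{SO}(3)$ if $\|w(A,B)-I\|\le\varepsilon$ for all $A,B\in\mathrm{SO}(3)$. *)

(* Defs.v *)
From HB Require Import structures.
From mathcomp Require Import all_boot all_order all_algebra.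
From mathcomp Require Import all_classical all_reals all_analysis.
Set Implicit Arguments.
Unset Strict Implicit.
Unset Printing Implicit Defensive.
Import Order.TTheory GRing.Theory Num.Theory.
Local Open Scope classical_set_scope.
Local Open Scope ring_scope.

(* A letter (g, s) is a^{+-1} if g = false and b^{+-1} if g = true;
   the exponent is +1 if s = false and -1 if s = true. *)
Definition letter : Type := (bool * bool)%type.
Definition linv (x : letter) : letter := (x.1, ~~ x.2).

Definition reduced (s : seq letter) : bool :=
  sorted (fun x y => y != linv x) s.

(* The free group on a, b, in its normal form: the carrier is the set of
   reduced words, and the product is concatenation followed by free reduction.
   The group laws and the universal property (word_eval) are proved below. *)
Record F2 := FreeWord { fword : seq letter; fwordP : reduced fword }.

HB.instance Definition _ := [isSub for fword].
HB.instance Definition _ := [Choice of F2 by <:].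

(* Left multiplication of a reduced word by one letter. *)
Definition push (x : letter) (s : seq letter) : seq letter :=
  if s is y :: s' then if y == linv x then s' else x :: s else [:: x].

Definition wmul (s t : seq letter) : seq letter := foldr push t s.
Definition winv (s : seq letter) : seq letter := rev (map linv s).

Lemma linvK : involutive linv.
Proof. by case=> g s; rewrite /linv /= negbK. Qed.

Lemma linv_inj : injective linv.
Proof. exact: inv_inj linvK. Qed.

Lemma reduced_tail x s : reduced (x :: s) -> reduced s.
Proof. by case: s => [|y s] //= /andP[]. Qed.

Lemma push_reduced x s : reduced s -> reduced (push x s).
Proof.
case: s => [|y s] //= ss; case: ifPn => [_|yx]; first exact: (@reduced_tail y).
by rewrite /= yx.
Qed.

Lemma pushK x s : reduced s -> push (linv x) (push x s) = s.
Proof.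
case: s => [|y s] /=; first by rewrite linvK eqxx.
case: ifPn => [/eqP ->|yx] ss; last by rewrite /= linvK eqxx.
by case: s ss => [|z s] //= /andP[/negPf ->].
Qed.

Lemma push_cons x s : reduced (x :: s) -> push x s = x :: s.
Proof. by case: s => [|y s] //= /andP[/negPf ->]. Qed.

Lemma wmul_reduced s t : reduced t -> reduced (wmul s t).
Proof. by move=> rt; elim: s => //= x s; exact: push_reduced. Qed.

Lemma wmul_push x s t : reduced s -> reduced t ->
  wmul (push x s) t = push x (wmul s t).
Proof.
case: s => [|y s] //= rs rt; case: ifPn => // /eqP ->.
by have := @pushK (linv x) (wmul s t); rewrite linvK => -> //; exact: wmul_reduced.
Qed.

Lemma wmulA s t u : reduced s -> reduced t -> reduced u ->
  wmul s (wmul t u) = wmul (wmul s t) u.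
Proof.
move=> rs rt ru; elim: s rs => //= x s IH rs.
by rewrite IH ?(reduced_tail rs)// wmul_push// wmul_reduced.
Qed.

Lemma wmuls0 s : reduced s -> wmul s [::] = s.
Proof.
elim: s => //= x s IH rs.
by rewrite IH ?(reduced_tail rs)// push_cons.
Qed.

Lemma winv_reduced s : reduced s -> reduced (winv s).
Proof.
rewrite /reduced /winv rev_sorted sorted_map => rs.
apply: sub_sorted rs => x y /=; apply: contra => /eqP/linv_inj ->.
by rewrite linvK.
Qed.

Lemma winvK : involutive winv.
Proof.
by move=> s; rewrite /winv map_rev revK -map_comp map_id_in// => x _ /=; rewrite linvK.
Qed.

Lemma wmulVs s : reduced s -> wmul (winv s) s = [::].
Proof.
elim: s => //= x s IH rs; rewrite /winv /= rev_cons -cats1 /wmul foldr_cat /=.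
by rewrite linvK eqxx; exact/IH/(reduced_tail rs).
Qed.

Lemma wmulsV s : reduced s -> wmul s (winv s) = [::].
Proof. by move=> /winv_reduced/wmulVs; rewrite winvK. Qed.

Definition F2_mul (u v : F2) : F2 :=
  FreeWord (wmul_reduced (fword u) (fwordP v)).
Definition F2_inv (u : F2) : F2 := FreeWord (winv_reduced (fwordP u)).
Definition F2_one : F2 := @FreeWord [::] isT.

Fact F2_mulA : associative F2_mul.
Proof. by move=> u v w; apply/val_inj/wmulA; apply: fwordP. Qed.
Fact F2_mul1g : left_id F2_one F2_mul.
Proof. by move=> u; apply/val_inj. Qed.
Fact F2_mulg1 : right_id F2_one F2_mul.
Proof. by move=> u; apply/val_inj/wmuls0/fwordP. Qed.
Fact F2_mulVg : left_inverse F2_one F2_inv F2_mul.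
Proof. by move=> u; apply/val_inj/wmulVs/fwordP. Qed.
Fact F2_mulgV : right_inverse F2_one F2_inv F2_mul.
Proof. by move=> u; apply/val_inj/wmulsV/fwordP. Qed.

HB.instance Definition _ := isGroup.Build F2
  F2_mulA F2_mul1g F2_mulg1 F2_mulVg F2_mulgV.

Definition F2_a : F2 := @FreeWord [:: (false, false)] isT.
Definition F2_b : F2 := @FreeWord [:: (true, false)] isT.

Definition word_length (w : F2) : nat := size (fword w).

Section WordEval.
Variables (G : groupType) (g h : G).
Local Open Scope group_scope.

Definition letter_eval (x : letter) : G :=
  let y := if x.1 then h else g in if x.2 then y^-1 else y.

Definition word_eval (w : F2) : G := foldr (fun x y => letter_eval x * y) 1 (fword w).

Lemma letter_evalV x : letter_eval (linv x) = (letter_eval x)^-1.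
Proof. by case: x => [[] []]; rewrite /letter_eval /= ?invgK. Qed.

Fact word_evalM : {morph word_eval : u v / u * v}.
Proof.
move=> [s rs] [t rt]; rewrite /word_eval /= => {rs rt}.
elim: s => [|x s IH] /=; first by rewrite mul1g.
rewrite -mulgA -IH; case: (wmul s t) => [|y u] //=.
by case: ifPn => //= /eqP ->; rewrite letter_evalV mulgA mulgV mul1g.
Qed.

Fact word_eval1 : word_eval 1 = 1. Proof. by []. Qed.

HB.instance Definition _ := isMultiplicative.Build F2 G word_eval word_evalM.
HB.instance Definition _ :=
  Multiplicative_isUMagmaMorphism.Build F2 G word_eval word_eval1.

Lemma word_eval_a : word_eval F2_a = g. Proof. exact: mulg1. Qed.
Lemma word_eval_b : word_eval F2_b = h. Proof. exact: mulg1. Qed.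

Lemma word_eval_unique (f : F2 -> G) : {morph f : u v / u * v} ->
  f F2_a = g -> f F2_b = h -> f =1 word_eval.
Proof.
move=> fM fa fb.
have f1 : f 1 = 1 by apply: (mulgI (f 1)); rewrite -fM !mulg1.
have fV u : f u^-1 = (f u)^-1.
  by apply: (mulgI (f u)); rewrite -fM !mulgV f1.
have fx x : f (@FreeWord [:: x] isT) = letter_eval x.
  case: x => [[] []]; rewrite /letter_eval /=.
  - by rewrite -fb -fV; congr f; apply/val_inj.
  - by rewrite -fb; congr f; apply/val_inj.
  - by rewrite -fa -fV; congr f; apply/val_inj.
  - by rewrite -fa; congr f; apply/val_inj.
case=> s; elim: s => [|x s IH] rs.
  by rewrite -[RHS]f1; congr f; apply/val_inj.
have rs' := reduced_tail rs.
rewrite [RHS]/word_eval /= -fx.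
rewrite -[X in _ * X]/(word_eval (FreeWord rs')) -IH -fM; congr f.
by apply/val_inj; rewrite /= push_cons.
Qed.

End WordEval.

Record SO3 (R : realType) := Rotation {
  so3_mx :> 'M[R]_3 ;
  so3P : (so3_mx *m so3_mx^T == 1%:M) && (\det so3_mx == 1) }.

HB.instance Definition _ (R : realType) := [isSub for @so3_mx R].
HB.instance Definition _ (R : realType) := [Choice of SO3 R by <:].

Section SO3Group.
Variable R : realType.
Implicit Types A B : SO3 R.

Lemma so3_mulT A : A *m A^T = 1%:M.
Proof. by case: A => A /= /andP[/eqP]. Qed.

Lemma so3_Tmul A : A^T *m A = 1%:M.
Proof. exact/mulmx1C/so3_mulT. Qed.

Lemma so3_det A : \det A = 1.
Proof. by case: A => A /= /andP[_ /eqP]. Qed.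

Fact so3_mul_subproof A B : (A *m B *m (A *m B)^T == 1%:M) && (\det (A *m B) == 1).
Proof.
by rewrite trmx_mul mulmxA -(mulmxA A) so3_mulT mulmx1 so3_mulT
  det_mulmx !so3_det mulr1 !eqxx.
Qed.

Fact so3_one_subproof :
  ((1%:M : 'M[R]_3) *m 1%:M^T == 1%:M) && (\det (1%:M : 'M[R]_3) == 1).
Proof. by rewrite trmx1 mulmx1 det1 !eqxx. Qed.

Fact so3_inv_subproof A : (A^T *m A^T^T == 1%:M) && (\det A^T == 1).
Proof. by rewrite trmxK so3_Tmul det_tr so3_det !eqxx. Qed.

Definition so3_mul A B : SO3 R := Rotation (so3_mul_subproof A B).
Definition so3_one : SO3 R := Rotation so3_one_subproof.
Definition so3_inv A : SO3 R := Rotation (so3_inv_subproof A).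

Fact so3_mulA : associative so3_mul.
Proof. by move=> A B C; apply/val_inj; rewrite /= mulmxA. Qed.
Fact so3_mul1g : left_id so3_one so3_mul.
Proof. by move=> A; apply/val_inj; rewrite /= mul1mx. Qed.
Fact so3_mulg1 : right_id so3_one so3_mul.
Proof. by move=> A; apply/val_inj; rewrite /= mulmx1. Qed.
Fact so3_mulVg : left_inverse so3_one so3_inv so3_mul.
Proof. by move=> A; apply/val_inj; rewrite /= so3_Tmul. Qed.
Fact so3_mulgV : right_inverse so3_one so3_inv so3_mul.
Proof. by move=> A; apply/val_inj; rewrite /= so3_mulT. Qed.

HB.instance Definition _ := isGroup.Build (SO3 R)
  so3_mulA so3_mul1g so3_mulg1 so3_mulVg so3_mulgV.

End SO3Group.

(* The library's norm on matrices is the entrywise maximum norm, hence the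
   following definitions. *)
Definition enorm (R : realType) (n : nat) (v : 'cV[R]_n) : R :=
  Num.sqrt (\sum_i v i 0 ^+ 2).

Definition opnorm (R : realType) (n : nat) (M : 'M[R]_n) : R :=
  sup [set enorm (M *m v) | v in [set v : 'cV[R]_n | enorm v <= 1]].

Definition almost_law (R : realType) (eps : R) (w : F2) : Prop :=
  w <> 1%g /\
  forall A B : SO3 R, opnorm (so3_mx (word_eval A B w) - 1%:M) <= eps.

(* The least length of an eps-almost law; a nonempty set of natural numbers
   attains its infimum, and the value is +oo if there is no eps-almost law. *)
Definition almost_law_length (R : realType) (eps : R) : \bar R :=
  ereal_inf [set ((word_length w)%:R)%:E | w in [set w | almost_law eps w]].

(* Main.v *)
Require Import Defs.
From HB Require Import structures.
From mathcomp Require Import all_boot all_order all_algebra.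
From mathcomp Require Import all_classical all_reals all_analysis.
From mathcomp Require Import ring lra.
Set Implicit Arguments.
Unset Strict Implicit.
Unset Printing Implicit Defensive.
Import Order.TTheory GRing.Theory Num.Theory.
Local Open Scope ring_scope.

(** Any two conjugate rotations g = a and h = b a b^-1 admit a Klein four-group
    of half-turns acting on them: in a suitable frame, the half-turn about the
    first axis inverts both, and the one about the second axis maps g to h^-1 and
    h to g^-1. Both are induced by length-preserving automorphisms of the free
    group on g and h. If w is a word in g and h, with unit quaternion
    (s; x1, x2, x3), and w' is its image under the half-turn about the first axis,
    then w w' has quaternion (1 - 2 x1^2; 2 x1 s, 2 x1 x3, - 2 x1 x2). So passing
    from w to w w' doubles the length, while the orders of smallness (r, p, q) of
    (x1, x2, x3) become (r, r + q, r + p) up to constants. Using the two half-turns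
    alternately, the order r of the largest coordinate obeys the tribonacci
    recursion r_(n+1) = r_n + r_(n-1) + r_(n-2). The process starts from a word that
    is uniformly small on all pairs of rotations. *)

(** * Unit quaternions *)

Section Quaternions.
Variable R : realType.

Definition quat : Type := (R * R * R * R)%type.

Implicit Types p q : quat.

Definition qnorm2 q : R := let: (s, x, y, z) := q in s ^+ 2 + x ^+ 2 + y ^+ 2 + z ^+ 2.

Definition qmul p q : quat :=
  let: (s, x, y, z) := p in let: (s', x', y', z') := q in
  (s * s' - x * x' - y * y' - z * z',
   s * x' + x * s' + y * z' - z * y',
   s * y' - x * z' + y * s' + z * x',
   s * z' + x * y' - y * x' + z * s').

Definition qconj q : quat := let: (s, x, y, z) := q in (s, - x, - y, - z).

(** The double cover of SO(3), through [rotation] below. Words are evaluated here because products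
    have polynomial coordinates. *)
Record uquat := UQuat { uq :> quat ; uqP : qnorm2 uq == 1 }.

HB.instance Definition _ := [isSub for uq].
HB.instance Definition _ := [Choice of uquat by <:].

Lemma quat_eq (s x y z s' x' y' z' : R) :
  s = s' -> x = x' -> y = y' -> z = z' -> (s, x, y, z) = (s', x', y', z').
Proof. by move=> -> -> -> ->. Qed.

Lemma qnorm2M p q : qnorm2 (qmul p q) = qnorm2 p * qnorm2 q.
Proof. by case: p q => [[[s x] y] z] [[[s' x'] y'] z'] /=; ring. Qed.

Lemma uquat_norm (q : uquat) : qnorm2 q = 1.
Proof. exact/eqP/uqP. Qed.

Fact uquat_mul_subproof (p q : uquat) : qnorm2 (qmul p q) == 1.
Proof. by rewrite qnorm2M !uquat_norm mulr1. Qed.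

Fact uquat_one_subproof : qnorm2 (1, 0, 0, 0) == 1.
Proof. by apply/eqP => /=; ring. Qed.

Fact uquat_inv_subproof (q : uquat) : qnorm2 (qconj q) == 1.
Proof.
by rewrite -(uquat_norm q); apply/eqP; case: q => [[[[s x] y] z] /= _]; ring.
Qed.

Definition uquat_mul (p q : uquat) := UQuat (uquat_mul_subproof p q).
Definition uquat_one := UQuat uquat_one_subproof.
Definition uquat_inv (q : uquat) := UQuat (uquat_inv_subproof q).

Fact uquat_mulA : associative uquat_mul.
Proof.
move=> [[[[s x] y] z] ?] [[[[s' x'] y'] z'] ?] [[[[s'' x''] y''] z''] ?].
by apply/val_inj; apply: quat_eq; ring.
Qed.
Fact uquat_mul1g : left_id uquat_one uquat_mul.
Proof. by move=> [[[[s x] y] z] ?]; apply/val_inj; apply: quat_eq; ring. Qed.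
Fact uquat_mulg1 : right_id uquat_one uquat_mul.
Proof. by move=> [[[[s x] y] z] ?]; apply/val_inj; apply: quat_eq; ring. Qed.
Fact uquat_mulVg : left_inverse uquat_one uquat_inv uquat_mul.
Proof.
move=> q; have := uquat_norm q; case: q => [[[[s x] y] z] ?] /= n1.
by apply/val_inj; apply: quat_eq; rewrite -?n1; ring.
Qed.
Fact uquat_mulgV : right_inverse uquat_one uquat_inv uquat_mul.
Proof.
move=> q; have := uquat_norm q; case: q => [[[[s x] y] z] ?] /= n1.
by apply/val_inj; apply: quat_eq; rewrite -?n1; ring.
Qed.

HB.instance Definition _ := isGroup.Build uquat
  uquat_mulA uquat_mul1g uquat_mulg1 uquat_mulVg uquat_mulgV.

Definition qre q : R := q.1.1.1.
Definition qi q : R := q.1.1.2.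
Definition qj q : R := q.1.2.
Definition qk q : R := q.2.

(* |vec q|^2 for a unit quaternion q, i.e. sin^2 of half the rotation angle. *)
Definition vnorm2 q : R := 1 - qre q ^+ 2.

Lemma vnorm2E (q : uquat) :
  vnorm2 q = let: (_, x, y, z) := uq q in x ^+ 2 + y ^+ 2 + z ^+ 2.
Proof.
have := uquat_norm q; case: q => [[[[s x] y] z] /= _].
by rewrite /vnorm2 /qre /= => <-; ring.
Qed.

Lemma vnorm2_ge0 (q : uquat) : 0 <= vnorm2 q.
Proof. by rewrite vnorm2E; case: q => [[[[s x] y] z] ?]; rewrite !addr_ge0 ?sqr_ge0. Qed.

Lemma vnorm2_le1 q : vnorm2 q <= 1.
Proof. by rewrite /vnorm2 gerBl sqr_ge0. Qed.

Local Open Scope group_scope.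

Lemma qreC (p q : uquat) : qre (p * q) = qre (q * p).
Proof.
by case: p q => [[[[s x] y] z] ?] [[[[s' x'] y'] z'] ?]; rewrite /qre /=; ring.
Qed.

Lemma vnorm2J (p q : uquat) : vnorm2 (p * q * p^-1) = vnorm2 q.
Proof. by rewrite /vnorm2 qreC mulgA mulVg mul1g. Qed.

(** With [d] the squared length of the cross product of the vector parts, the commutator has real
    part [1 - 2 * d], hence [vnorm2] equal to [4 * d - 4 * d ^+ 2]. Lagrange's identity bounds [d]
    by the product of both [vnorm2]. *)
Lemma vnorm2_comm (p q : uquat) :
  (vnorm2 (p * q * p^-1 * q^-1)%g <= 4 * vnorm2 p * vnorm2 q)%R.
Proof.
have -> : p * q * p^-1 * q^-1 = (p * q) * (q * p)^-1 by rewrite invgM mulgA.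
have := uquat_norm p; have := uquat_norm q.
rewrite (vnorm2E p) (vnorm2E q) /vnorm2 /qre.
case: p q => [[[[s x] y] z] ?] [[[[s' x'] y'] z'] ?] /= n1 n2.
set a := (y * z' - z * y')%R; set b := (z * x' - x * z')%R; set c := (x * y' - y * x')%R.
set t := (X in (1 - X ^+ 2)%R).
have -> : t = (1 - 2 * (a ^+ 2 + b ^+ 2 + c ^+ 2))%R.
  transitivity ((s ^+ 2 + x ^+ 2 + y ^+ 2 + z ^+ 2) *
    (s' ^+ 2 + x' ^+ 2 + y' ^+ 2 + z' ^+ 2) - 2 * (a ^+ 2 + b ^+ 2 + c ^+ 2))%R.
    rewrite /t /a /b /c; ring.
  by rewrite n1 n2 mulr1.
have h : (a ^+ 2 + b ^+ 2 + c ^+ 2 <=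
    (x ^+ 2 + y ^+ 2 + z ^+ 2) * (x' ^+ 2 + y' ^+ 2 + z' ^+ 2))%R.
  rewrite -subr_ge0.
  have -> : ((x ^+ 2 + y ^+ 2 + z ^+ 2) * (x' ^+ 2 + y' ^+ 2 + z' ^+ 2) -
      (a ^+ 2 + b ^+ 2 + c ^+ 2) = (x * x' + y * y' + z * z') ^+ 2)%R.
    by rewrite /a /b /c; ring.
  exact: sqr_ge0.
have := sqr_ge0 (a ^+ 2 + b ^+ 2 + c ^+ 2)%R.
set d := (a ^+ 2 + b ^+ 2 + c ^+ 2)%R in h *.
move=> d2.
have -> : (1 - (1 - 2 * d) ^+ 2 = 4 * d - 4 * d ^+ 2)%R by ring.
rewrite -mulrA; lra.
Qed.

End Quaternions.

(** * Powers of a unit quaternion close to 1 *)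

Section Dirichlet.
Variable R : realType.
Implicit Types p q : uquat R.

(** The real part of [p^-1 * q] is the inner product of [p] and [q], which is [1 - d / 2] for the
    squared distance [d]. *)
Lemma vnorm2_div p q : vnorm2 (p^-1 * q)%g <=
  (qre p - qre q) ^+ 2 + (qi p - qi q) ^+ 2 +
  (qj p - qj q) ^+ 2 + (qk p - qk q) ^+ 2.
Proof.
have := uquat_norm p; have := uquat_norm q; rewrite /vnorm2 /qre /qi /qj /qk.
case: p q => [[[[s x] y] z] ?] [[[[s' x'] y'] z'] ?] /= n1 n2.
set d := (X in _ <= X); set t := (X in 1 - X ^+ 2).
have -> : t = 1 - d / 2.
  transitivity (((s ^+ 2 + x ^+ 2 + y ^+ 2 + z ^+ 2) +
    (s' ^+ 2 + x' ^+ 2 + y' ^+ 2 + z' ^+ 2)) / 2 - d / 2); last first.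
    by rewrite n1 n2; field.
  by rewrite /t /d; field.
have := sqr_ge0 d; rewrite (_ : 1 - _ = d - d ^+ 2 / 4); last by field.
lra.
Qed.

Lemma uquat_coord_bound q : [/\ `|qre q| <= 1, `|qi q| <= 1, `|qj q| <= 1 & `|qk q| <= 1].
Proof.
have := uquat_norm q; rewrite /qre /qi /qj /qk.
case: q => [[[[s x] y] z] ?] /= n1.
by split; rewrite -(ler_pXn2r (isT : 0 < 2)%N) ?nnegrE ?normr_ge0 ?ler01 //
    expr1n real_normK ?num_real //;
  rewrite -n1; have := (sqr_ge0 s, sqr_ge0 x, sqr_ge0 y, sqr_ge0 z) => -[[[]]]; lra.
Qed.

(** Pigeonhole on a grid of cubes: two of the powers of [q] with exponents 0, ..., [K] share a cube,
    and their quotient is a power close to 1. The number [K] of cubes depends on [e] alone. *)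
Lemma uquat_Dirichlet (e : R) : 0 < e -> exists K : nat, forall q,
  exists k : nat, [/\ (0 < k)%N, (k <= K)%N & vnorm2 (q ^+ k)%g <= e].
Proof.
(* Points of one cell differ by at most [1 / D] in each coordinate, and
   [1 / D ^+ 2 <= 1 / D < e / 4]; four coordinates give at most [e]. *)
move=> e0; pose D := (Num.truncn (4 / e)).+1.
have De : 4 / e < D%:R by exact: truncnS_gt.
have D1 : 1 <= D%:R :> R by rewrite (ler_nat R 1).
have D0 : 0 < D%:R :> R by lra.
(* For [x] in [-1, 1] the index is at most [2 * D], so [inord] does not fall back on its default. *)
pose cell (x : R) : 'I_(2 * D).+1 := inord (Num.truncn ((x + 1) * D%:R)).
have cellP x y : `|x| <= 1 -> `|y| <= 1 -> cell x = cell y -> (x - y) ^+ 2 <= e / 4.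
  move=> /ler_normlP[x1 x2] /ler_normlP[y1 y2] /(congr1 (@nat_of_ord _)).
  have h (w : R) : - w <= 1 -> w <= 1 -> (Num.truncn ((w + 1) * D%:R) < (2 * D).+1)%N.
    move=> w1 w2; rewrite ltnS -(ler_nat R).
    have /truncn_itv/andP[h _] : 0 <= (w + 1) * D%:R by apply: mulr_ge0; lra.
    by apply: (le_trans h); rewrite natrM ler_pM2r //; lra.
  rewrite !inordK ?h //.
  set u := (x + 1) * _; set v := (y + 1) * _.
  have u0 : 0 <= u by apply: mulr_ge0; lra.
  have v0 : 0 <= v by apply: mulr_ge0; lra.
  have /andP[] := truncn_itv u0; have /andP[] := truncn_itv v0.
  move=> v1 v2 u1 u2 uv; rewrite uv in u1 u2.
  have {v1 v2 u1 u2 uv} : (u - v) ^+ 2 <= 1.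
    rewrite -real_normK ?num_real // expr_le1 ?normr_ge0 //; apply/ler_normlP.
    by rewrite -natr1 in u2 v2; split; lra.
  have -> : (u - v) = (x - y) * D%:R by rewrite /u /v; ring.
  rewrite exprMn => h1.
  have h2 : (x - y) ^+ 2 * D%:R <= 1.
    apply: le_trans h1; rewrite ler_wpM2l ?sqr_ge0 // ler_eXnr //.
  have : (x - y) ^+ 2 * (4 / e) <= 1.
    apply: le_trans h2; rewrite ler_wpM2l ?sqr_ge0 //; exact: ltW.
  by rewrite mulrA ler_pdivrMr // mul1r; lra.
pose T := ('I_(2 * D).+1 * 'I_(2 * D).+1 * 'I_(2 * D).+1 * 'I_(2 * D).+1)%type.
exists #|{: T}| => q.
pose f (i : 'I_#|{: T}|.+1) : T :=
  let p := (q ^+ i)%g in (cell (qre p), cell (qi p), cell (qj p), cell (qk p)).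
have /injectivePn[i [j ij fij]] : ~~ injectiveb f.
  apply/negP => /injectiveP /leq_card; by rewrite card_ord ltnn.
wlog lij : i j ij fij / (i < j)%N.
  move=> H; have : nat_of_ord i != j by [].
  rewrite neq_ltn => /orP[] h.
    exact: (H i j).
  by apply: (H j i) => //; rewrite eq_sym.
exists (j - i)%N; split; rewrite ?subn_gt0 //.
  by apply: leq_trans (leq_subr _ _) _; rewrite -ltnS.
have -> : (q ^+ (j - i) = (q ^+ i)^-1 * q ^+ j)%g.
  by rewrite -{2}(subnKC (ltnW lij)) expgnDr mulgA mulVg mul1g.
apply: le_trans (vnorm2_div _ _) _.
have [a1 a2 a3 a4] := uquat_coord_bound (q ^+ i)%g.
have [b1 b2 b3 b4] := uquat_coord_bound (q ^+ j)%g.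
case: fij => /(cellP _ _ a1 b1) h1 /(cellP _ _ a2 b2) h2 /(cellP _ _ a3 b3) h3
  /(cellP _ _ a4 b4) h4.
lra.
Qed.

End Dirichlet.

(** * Uniformly small words *)

Notation la := ((false, false) : letter).
Notation la' := ((false, true) : letter).
Notation lb := ((true, false) : letter).
Notation lb' := ((true, true) : letter).

Section SeqEval.
Variables (G : groupType) (g h : G).
Local Open Scope group_scope.

Definition seq_eval (s : seq letter) : G :=
  foldr (fun x y => letter_eval g h x * y) 1 s.

Lemma seq_eval_cat s t : seq_eval (s ++ t) = seq_eval s * seq_eval t.
Proof. by elim: s => [|x s IH] /=; rewrite ?mul1g // IH mulgA. Qed.

Lemma seq_eval_winv s : seq_eval (winv s) = (seq_eval s)^-1.
Proof.
elim: s => [|x s IH]; first by rewrite invg1.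
rewrite /winv /= rev_cons -cats1 seq_eval_cat [seq_eval (rev _)]IH /= mulg1.
by rewrite letter_evalV invgM.
Qed.

Lemma seq_eval_wmul s t : reduced s -> reduced t ->
  seq_eval (wmul s t) = seq_eval s * seq_eval t.
Proof. by move=> rs rt; exact: (word_evalM g h (FreeWord rs) (FreeWord rt)). Qed.

Lemma seq_eval_nseq k : seq_eval (nseq k la) = g ^+ k.
Proof. by elim: k => //= k ->; rewrite expgS. Qed.

End SeqEval.

Definition wcomm (s t : seq letter) : seq letter := s ++ t ++ winv s ++ winv t.

Lemma seq_eval_wcomm (G : groupType) (g h : G) s t :
  (seq_eval g h (wcomm s t) = seq_eval g h s * seq_eval g h t *
    (seq_eval g h s)^-1 * (seq_eval g h t)^-1)%g.
Proof. by rewrite !seq_eval_cat !seq_eval_winv !mulgA. Qed.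

(** The outer letters are recorded because they decide whether a concatenation stays reduced. *)
Definition reduced_from_to (x y : letter) (s : seq letter) : Prop :=
  reduced s /\ exists2 t, s = x :: t & last x t = y.

Lemma reduced_from_to_cat (x y x' y' : letter) s s' : x' != linv y ->
  reduced_from_to x y s -> reduced_from_to x' y' s' ->
  reduced_from_to x y' (s ++ s').
Proof.
move=> nc [rs [t es lt]] [rs' [t' es' lt']]; split; last first.
  by exists (t ++ s'); rewrite ?es // last_cat es'.
rewrite es es' /reduced /= cat_path; move: rs rs'; rewrite es es' /reduced /= => -> /=.
by rewrite lt nc.
Qed.

Lemma reduced_from_to_winv x y s :
  reduced_from_to x y s -> reduced_from_to (linv y) (linv x) (winv s).
Proof.
move=> [rs [t es lt]]; split; first exact: winv_reduced.
rewrite es /winv; exists (rev (map linv (belast x t))).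
  by rewrite lastI lt map_rcons rev_rcons.
have -> : last (linv y) (rev (map linv (belast x t))) = last x (rev (map linv (x :: t))).
  by rewrite [x :: t]lastI lt map_rcons rev_rcons.
by rewrite /= rev_cons last_rcons.
Qed.

Lemma reduced_from_to1 x : reduced_from_to x x [:: x].
Proof. by split=> //; exists [::]. Qed.

Lemma reduced_from_to_nseq k : reduced_from_to la la (nseq k.+1 la).
Proof.
split; first by rewrite /reduced /=; elim: k.
by exists (nseq k la) => //; elim: k.
Qed.

Lemma reduced_from_to_wcomm (x y x' y' : letter) s t :
  x' != linv y -> y != y' -> x' != x ->
  linv y' != x -> reduced_from_to x y s -> reduced_from_to x' y' t ->
  reduced_from_to x (linv x') (wcomm s t).
Proof.
move=> h1 h2 h3 h4 fs ft.
have [fs' ft'] := (reduced_from_to_winv fs, reduced_from_to_winv ft).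
apply: (reduced_from_to_cat h1 fs).
apply: (reduced_from_to_cat _ ft (reduced_from_to_cat _ fs' ft')).
  by rewrite (inj_eq linv_inj).
by rewrite linvK.
Qed.

Definition wconj (x : letter) (s : seq letter) : seq letter := [:: x] ++ s ++ [:: linv x].

Lemma seq_eval_wconj (G : groupType) (g h : G) x s :
  (seq_eval g h (wconj x s) =
   letter_eval g h x * seq_eval g h s * (letter_eval g h x)^-1)%g.
Proof. by rewrite /wconj !seq_eval_cat /= !mulg1 letter_evalV mulgA. Qed.

Lemma reduced_from_to_wconj (x y z : letter) s : y != linv x -> z != x ->
  reduced_from_to y z s -> reduced_from_to x (linv x) (wconj x s).
Proof.
move=> h1 h2 fs; apply: (reduced_from_to_cat h1 (reduced_from_to1 x)).
apply: (reduced_from_to_cat _ fs (reduced_from_to1 _)).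
by rewrite (inj_eq linv_inj) eq_sym.
Qed.

(* [v, a^(k+1)] is small if [v] or [a^(k+1)] is, up to a factor that the commutator
   of two of its conjugates absorbs; so smallness persists under iteration, and by
   Dirichlet's theorem it occurs after a bounded number of steps. *)
Definition shrink_step (k : nat) (v : seq letter) : seq letter :=
  let f := wconj lb (wcomm v (nseq k.+1 la)) in
  wconj lb (wcomm f (wconj la f)).

(** [iteri] passes the indices 0, ..., [k - 1], so the powers of [a] used are those with exponents
    1, ..., [k]. *)
Definition shrink (k : nat) : seq letter :=
  iteri k shrink_step (wconj lb [:: la]).

(** Each commutator begins with [b] and ends with [a^-1]; conjugation by [b] then restores the outer
    letters [b] and [b^-1], so nothing ever cancels and the word stays non-trivial. *)
Lemma shrink_reduced k : reduced_from_to lb lb' (shrink k).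
Proof.
elim: k => [|k IH]; first by split=> //; exists [:: la; lb'].
have ff : reduced_from_to lb lb' (wconj lb (wcomm (shrink k) (nseq k.+1 la))).
  apply: (reduced_from_to_wconj (y := lb) (z := la')) => //.
  exact: reduced_from_to_wcomm IH (reduced_from_to_nseq k).
apply: (reduced_from_to_wconj (y := lb) (z := la')) => //.
apply: (reduced_from_to_wcomm _ _ _ _ ff
  (reduced_from_to_wconj (x := la) _ _ ff)) => //.
Qed.

Section Shrink.
Variable R : realType.

(** If one entry of the inner commutator is small, the other is at most 1, so the commutator is at
    most [4 * e]. The outer one is then at most [4 * (4 * e) ^+ 2], that is [64 * e ^+ 2], which is
    at most [e]. *)
Lemma vnorm2_shrink_step (e : R) k v (g h : uquat R) : 0 < e -> e <= 64^-1 ->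
  vnorm2 (seq_eval g h v) <= e \/ vnorm2 (g ^+ k.+1)%g <= e ->
  vnorm2 (seq_eval g h (shrink_step k v)) <= e.
Proof.
move=> e0 e64 small; rewrite /shrink_step; set f := wconj lb (wcomm v _).
have fe : vnorm2 (seq_eval g h f) <= 4 * e.
  rewrite seq_eval_wconj vnorm2J seq_eval_wcomm seq_eval_nseq.
  apply: le_trans (vnorm2_comm _ _) _.
  case: small => h1.
    rewrite -[leRHS]mulr1; apply: ler_pM; rewrite ?mulr_ge0 ?vnorm2_ge0 ?vnorm2_le1 //.
    by rewrite ler_pM2l.
  rewrite -mulrA ler_pM2l // -[leRHS]mul1r.
  by apply: ler_pM; rewrite ?vnorm2_ge0 ?vnorm2_le1.
rewrite seq_eval_wconj vnorm2J seq_eval_wcomm.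
apply: le_trans (vnorm2_comm _ _) _.
rewrite seq_eval_wconj vnorm2J.
have f0 := vnorm2_ge0 (seq_eval g h f).
move: fe f0; set t := vnorm2 _ => te t0.
have : t * t <= (4 * e) * (4 * e) by apply: ler_pM.
have : e * e <= 64^-1 * e by rewrite ler_pM2r.
lra.
Qed.

Lemma exists_small_word (e : R) : 0 < e -> e <= 64^-1 ->
  exists2 s, reduced_from_to lb lb' s &
    forall g h : uquat R, vnorm2 (seq_eval g h s) <= e.
Proof.
move=> e0 e64; have [K HK] := uquat_Dirichlet e0.
exists (shrink K); first exact: shrink_reduced.
move=> g h; have [k [k0 kK gk]] := HK g.
elim: K kK {HK} => [|K IH]; first by case: k k0 gk.
(* The step that uses the exponent [k] makes the word small; all later steps keep it small. *)
rewrite leq_eqVlt => /orP[/eqP ek|kK]; apply: vnorm2_shrink_step => //.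
  by right; rewrite -ek.
by left; apply: IH.
Qed.

End Shrink.

(* The Klein four-group acting on letters: [t.1] exchanges the two generators,
   [t.2] inverts them. *)
Definition actl (t : bool * bool) (x : letter) : letter := (x.1 (+) t.1, x.2 (+) t.2).

Lemma actl_linv t x : actl t (linv x) = linv (actl t x).
Proof. by case: t x => [[] []] [[] []]. Qed.

Lemma actl_inj t : injective (actl t).
Proof. by case: t => [[] []] [[] []] [[] []]. Qed.

Lemma reduced_actl t s : reduced s -> reduced (map (actl t) s).
Proof.
rewrite /reduced sorted_map; apply: sub_sorted => x y /=.
by rewrite -actl_linv (inj_eq (@actl_inj t)).
Qed.

(** * Cancellation between a word and its image under the Klein four-group *)

Lemma wmul_cat s t : reduced (s ++ t) -> wmul s t = s ++ t.
Proof.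
elim: s => //= x s IH r; rewrite IH ?(reduced_tail r) //.
exact: push_cons.
Qed.

Lemma wmul_cancel s x t : wmul (s ++ [:: x]) (linv x :: t) = wmul s t.
Proof. by rewrite /wmul foldr_cat /= eqxx. Qed.

Definition double_word (t : bool * bool) (s : seq letter) : seq letter :=
  wmul s (map (actl t) s).

(* Since the Klein four-group acts simply transitively on letters, a word of this
   form and its image under [actl r] cancel by at most one letter. *)
Definition doubling_shape (t : bool * bool) (s : seq letter) : Prop :=
  reduced s /\ exists m, s = [:: la, la & m] ++ [:: actl t lb'; actl t la'].

Lemma reduced_cat x s y t : reduced (rcons s x) -> reduced (y :: t) ->
  y != linv x -> reduced (rcons s x ++ y :: t).
Proof.
case: s => [|z s]; rewrite /reduced /= ?cat_path => r1 r2 h.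
  by rewrite h.
by rewrite r1 /= last_rcons h.
Qed.

(** At the junction [actl t la'] meets [actl r la]. These cancel only if [t = r]; then [actl t lb']
    meets the second [actl r la], a different generator, and cancellation stops. So the outer pairs
    of letters survive. *)
Lemma doubling_shape_double r t s : doubling_shape t s ->
  doubling_shape (t.1 (+) r.1, t.2 (+) r.2) (double_word r s).
Proof.
move=> [rs [m es]]; split; first by apply: wmul_reduced; exact: reduced_actl.
have acomp x : actl (t.1 (+) r.1, t.2 (+) r.2) x = actl r (actl t x).
  by rewrite /actl /= !addbA.
rewrite !acomp /double_word.
have rv := reduced_actl r rs.
case: t es acomp => t1 t2; case: r rv => r1 r2 /= rv es acomp.
have es' : s = rcons (rcons [:: la, la & m] (actl (t1, t2) lb')) (actl (t1, t2) la').
  by rewrite es -!cats1 -!catA.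
have rs1 : reduced (rcons [:: la, la & m] (actl (t1, t2) lb')).
  by move: rs; rewrite es' -cats1 => rs; exact: (cat_sorted2 rs).1.
have ev : map (actl (r1, r2)) s = actl (r1, r2) la :: (actl (r1, r2) la ::
     map (actl (r1, r2)) m ++
     [:: actl (r1, r2) (actl (t1, t2) lb'); actl (r1, r2) (actl (t1, t2) la')]).
  by rewrite es /= map_cat.
have [[e1 e2]|ntr] := eqVneq (t1, t2) (r1, r2).
  exists (m ++ [:: actl (r1, r2) lb', actl (r1, r2) la & map (actl (r1, r2)) m]).
  rewrite ev {1}es' e1 e2 -[_ la as X in X :: _]/(actl (r1, r2) (linv la')) actl_linv.
  rewrite -cats1 wmul_cancel wmul_cat; first by rewrite -!cats1 -!catA.
  rewrite -e1 -e2; apply: reduced_cat => //; last by case: (t1) (t2) => [] [].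
  by move: rv; rewrite ev -actl_linv e1 e2 => /reduced_tail.
exists (m ++ [:: actl (t1, t2) lb', actl (t1, t2) la', actl (r1, r2) la, actl (r1, r2) la &
  map (actl (r1, r2)) m]).
rewrite wmul_cat ev; first by rewrite es /= -!catA.
rewrite es'; apply: reduced_cat; rewrite -?es' -?ev //.
by case: (t1) (t2) (r1) (r2) ntr {rv es acomp rs1 es' ev} => [] [] [] [].
Qed.

(** For a small [v] from [b] to [b^-1], the word [a [a v a^-1, v] a^-1] begins with [a a] and ends
    with [b^-1 a^-1]. The commutator only improves smallness. *)
Lemma small_word_shape (R : realType) (e : R) : 0 < e -> e <= 64^-1 ->
  exists2 s, doubling_shape (false, false) s &
    forall g h : uquat R, vnorm2 (seq_eval g h s) <= e.
Proof.
move=> e0 e64; have [v fv ve] := exists_small_word e0 e64.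
have fz : reduced_from_to la la' (wconj la v).
  exact: (reduced_from_to_wconj _ _ fv).
have [rf [t et lt]] : reduced_from_to la lb' (wcomm (wconj la v) v).
  exact: (reduced_from_to_wcomm _ _ _ _ fz fv).
exists (wconj la (wcomm (wconj la v) v)).
  split.
    exact: (reduced_from_to_wconj _ _ (conj rf (ex_intro2 _ _ t et lt))).1.
  case/lastP: t et lt => [|t x]; first by [].
  rewrite last_rcons => et ex; exists t.
  by rewrite /wconj et ex /= -cats1 -catA.
move=> g h; rewrite seq_eval_wconj vnorm2J seq_eval_wcomm.
apply: le_trans (vnorm2_comm _ _) _; rewrite seq_eval_wconj vnorm2J.
have := ve g h; have := vnorm2_ge0 (seq_eval g h v); set n := vnorm2 _ => n0 ne.
have : n * n <= 64^-1 * n by rewrite ler_wpM2r // (le_trans ne).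
lra.
Qed.

(** * The tribonacci recursion *)

Lemma seq_eval_morph (G H : groupType) (f : G -> H) (g h : G) s :
  {morph f : x y / (x * y)%g} -> f (seq_eval g h s) = seq_eval (f g) (f h) s.
Proof.
move=> fM; have f1 : f 1%g = 1%g by apply: (mulgI (f 1%g)); rewrite -fM !mulg1.
have fV x : f x^-1%g = (f x)^-1%g by apply: (mulgI (f x)); rewrite -fM !mulgV.
by elim: s => //= -[[] []] s IH; rewrite fM IH /letter_eval /= ?fV.
Qed.

Lemma seq_eval_actl (G : groupType) (g h : G) t s :
  seq_eval g h (map (actl t) s) =
  seq_eval (letter_eval g h (actl t la)) (letter_eval g h (actl t lb)) s.
Proof.
elim: s => //= x s <-; congr (_ * _)%g.
by case: t x => [[] []] [[] []]; rewrite /letter_eval /= ?invgK.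
Qed.

(** The flag [(false, true)] of the even steps is the half-turn about the first axis, [(true, true)]
    of the odd steps the one about the second. *)
Fixpoint tribonacci_word (s : seq letter) (n : nat) : seq letter :=
  if n is n'.+1 then double_word (odd n', true) (tribonacci_word s n') else s.

Lemma tribonacci_word_shape s n : doubling_shape (false, false) s ->
  exists t, doubling_shape t (tribonacci_word s n).
Proof.
move=> fs; elim: n => [|n [t IH]]; first by exists (false, false).
by eexists; exact: (doubling_shape_double (odd n, true) IH).
Qed.

Lemma size_push x s : (size (push x s) <= (size s).+1)%N.
Proof. by case: s => //= y s; case: ifP => //= _; rewrite ltnW. Qed.

Lemma size_wmul s t : (size (wmul s t) <= size s + size t)%N.
Proof.
by elim: s => //= x s IH; rewrite addSn; apply: leq_trans (size_push _ _) _.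
Qed.

Lemma size_tribonacci_word s n : (size (tribonacci_word s n) <= 2 ^ n * size s)%N.
Proof.
elim: n => [|n IH]; first by rewrite mul1n.
apply: leq_trans (size_wmul _ _) _.
by rewrite size_map addnn -mul2n expnS -mulnA leq_mul2l.
Qed.

(** * Quaternion coordinates under doubling *)

Section Tribonacci.
Variable R : realType.
Implicit Types g h w : uquat R.

Fact uquat_i_subproof : qnorm2 (0, 1, 0, 0) == 1 :> R.
Proof. by apply/eqP => /=; ring. Qed.
Fact uquat_j_subproof : qnorm2 (0, 0, 1, 0) == 1 :> R.
Proof. by apply/eqP => /=; ring. Qed.
Definition uquat_i : uquat R := UQuat uquat_i_subproof.
Definition uquat_j : uquat R := UQuat uquat_j_subproof.

(** Equal angles, and axes orthogonal to the first coordinate axis that the half-turn about the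
    third one exchanges. *)
Definition symmetric_pair g h : Prop :=
  exists s c d, uq g = (s, 0, c, d) /\ uq h = (s, 0, - c, d).

Lemma conj_morph (k : uquat R) : {morph (fun w => k * w * k^-1)%g : x y / (x * y)%g}.
Proof. by move=> x y /=; rewrite !mulgA mulgVK. Qed.

Lemma symmetric_pair_i g h : symmetric_pair g h ->
  (uquat_i * g * uquat_i^-1 = g^-1)%g /\ (uquat_i * h * uquat_i^-1 = h^-1)%g.
Proof.
case: g h => [g ng] [h nh] [s [c [d [/= eg eh]]]]; subst g h.
by split; apply/val_inj; apply: quat_eq => /=; ring.
Qed.

Lemma symmetric_pair_j g h : symmetric_pair g h ->
  (uquat_j * g * uquat_j^-1 = h^-1)%g /\ (uquat_j * h * uquat_j^-1 = g^-1)%g.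
Proof.
case: g h => [g ng] [h nh] [s [c [d [/= eg eh]]]]; subst g h.
by split; apply/val_inj; apply: quat_eq => /=; ring.
Qed.

(** The half-turn is conjugation by [uquat_i], which commutes with the evaluation of words; the
    image of [(t, x, y, z)] is [(t, x, - y, - z)]. *)
Lemma double_word_i g h s : reduced s -> symmetric_pair g h ->
  let: (t, x, y, z) := uq (seq_eval g h s) in
  let v := seq_eval g h (double_word (false, true) s) in
  [/\ qi v = 2 * t * x, qj v = 2 * x * z & qk v = - (2 * x * y)].
Proof.
move=> rs /symmetric_pair_i[ig ih].
rewrite /double_word seq_eval_wmul ?reduced_actl // seq_eval_actl.
have -> : letter_eval g h (actl (false, true) la) = (uquat_i * g * uquat_i^-1)%g by rewrite ig.
have -> : letter_eval g h (actl (false, true) lb) = (uquat_i * h * uquat_i^-1)%g by rewrite ih.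
rewrite -(seq_eval_morph g h s (conj_morph uquat_i)).
case: (seq_eval g h s) => [[[[t x] y] z] n] /=.
by split; rewrite /qi /qj /qk /=; ring.
Qed.

Lemma double_word_j g h s : reduced s -> symmetric_pair g h ->
  let: (t, x, y, z) := uq (seq_eval g h s) in
  let v := seq_eval g h (double_word (true, true) s) in
  [/\ qi v = - (2 * y * z), qj v = 2 * t * y & qk v = 2 * y * x].
Proof.
move=> rs /symmetric_pair_j[ig ih].
rewrite /double_word seq_eval_wmul ?reduced_actl // seq_eval_actl.
have -> : letter_eval g h (actl (true, true) la) = (uquat_j * g * uquat_j^-1)%g by rewrite ig.
have -> : letter_eval g h (actl (true, true) lb) = (uquat_j * h * uquat_j^-1)%g by rewrite ih.
rewrite -(seq_eval_morph g h s (conj_morph uquat_j)).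
case: (seq_eval g h s) => [[[[t x] y] z] n] /=.
by split; rewrite /qi /qj /qk /=; ring.
Qed.

Lemma uquat_re_le1 w : `|qre w| <= 1.
Proof. by have [] := uquat_coord_bound w. Qed.

(** [S] bounds the coordinate along the axis of the next half-turn, [P] the other one of the first
    two, [Q] the third. Doubling turns the bounds [(S, P, Q)] into [(2 S Q, 2 S, 2 S P)], and
    alternating the axes puts the new [S] on the next axis. *)
Lemma tribonacci_bounds (P Q S : nat -> R) g h s :
  symmetric_pair g h -> doubling_shape (false, false) s ->
  (forall n, 0 <= P n) -> (forall n, 0 <= Q n) -> (forall n, 0 <= S n) ->
  (forall n, 2 * S n <= P n.+1) -> (forall n, 2 * S n * P n <= Q n.+1) ->
  (forall n, 2 * S n * Q n <= S n.+1) ->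
  `|qi (seq_eval g h s)| <= S 0 -> `|qj (seq_eval g h s)| <= P 0 ->
  `|qk (seq_eval g h s)| <= Q 0 ->
  forall n, let w := seq_eval g h (tribonacci_word s n) in
  [/\ `|qi w| <= (if odd n then P n else S n),
      `|qj w| <= (if odd n then S n else P n) & `|qk w| <= Q n].
Proof.
move=> gh fs P0 Q0 S0 hP hQ hS hi hj hk; elim=> [|n IH]; first by [].
have [t [rw _]] := tribonacci_word_shape n fs.
have := uquat_re_le1 (seq_eval g h (tribonacci_word s n)).
move: IH; rewrite /= if_neg if_neg.
have bound1 a b : `|a| <= 1 -> `|b| <= S n -> `|2 * a * b| <= P n.+1.
  move=> ha hb; apply: le_trans (hP n); rewrite !normrM ger0_norm // -mulrA.
  by rewrite ler_pM2l // -[leRHS]mul1r; apply: ler_pM.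
have bound2 a b : `|a| <= S n -> `|b| <= Q n -> `|2 * a * b| <= S n.+1.
  move=> ha hb; apply: le_trans (hS n); rewrite !normrM ger0_norm //.
  by apply: ler_pM; rewrite ?mulr_ge0 // ler_pM2l.
have bound3 a b : `|a| <= S n -> `|b| <= P n -> `|2 * a * b| <= Q n.+1.
  move=> ha hb; apply: le_trans (hQ n); rewrite !normrM ger0_norm //.
  by apply: ler_pM; rewrite ?mulr_ge0 // ler_pM2l.
case: (odd n).
  have := double_word_j rw gh; case: (uq (seq_eval g h _)) => [[[a x] y] z].
  rewrite /= /qre /= => -[-> -> ->] [hx hy hz] ha; rewrite normrN.
  by split; [exact: bound2 | exact: bound1 | exact: bound3].
have := double_word_i rw gh; case: (uq (seq_eval g h _)) => [[[a x] y] z].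
rewrite /= /qre /= => -[-> -> ->] [hx hy hz] ha; rewrite normrN.
by split; [exact: bound1 | exact: bound2 | exact: bound3].
Qed.

(** The number [y ^+ 2 - y] is the relative order of smallness of the third coordinate below; being
    above 1, it does no harm to the common bound. *)
Lemma tribonacci_root_gt (y : R) : 1 < y -> y ^+ 3 = y ^+ 2 + y + 1 -> 1 < y ^+ 2 - y.
Proof.
move=> y1 ey; rewrite -(ltr_pM2l (_ : 0 < y)); last by lra.
have -> : y * (y ^+ 2 - y) = y ^+ 3 - y ^+ 2 by ring.
by rewrite ey; lra.
Qed.

(** The parameter [L] is left free in order to absorb the constant in the passage to operator
    norms. *)
Lemma exists_tribonacci_words (L y : R) : 0 < L -> 1 < y ->
  y ^+ 3 = y ^+ 2 + y + 1 ->
  exists2 s, doubling_shape (false, false) s &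
    forall g h, symmetric_pair g h -> forall n,
    let w := seq_eval g h (tribonacci_word s n) in
    let b := expR (- (L * y ^+ n)) in
    [/\ `|qi w| <= b, `|qj w| <= b & `|qk w| <= b].
Proof.
move=> L0 y1 ey; have y2 := tribonacci_root_gt y1 ey.
(* Small enough to lie below [S 0], [P 0] and [Q 0] at once. *)
pose eta : R := 8^-1 * expR (- (L * y ^+ 2)).
have eta0 : 0 < eta by rewrite mulr_gt0 ?expR_gt0 // invr_gt0.
have eta8 : eta <= 8^-1.
  rewrite -[leRHS]mulr1 ler_pM2l ?invr_gt0 // -expR0 ler_expR oppr_le0.
  by rewrite mulr_ge0 ?exprn_ge0 //; lra.
have e64 : eta ^+ 2 <= 64^-1.
  by rewrite (_ : 64^-1 = 8^-1 ^+ 2); [rewrite ler_pXn2r ?nnegrE //; lra | field].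
have [s fs small] := small_word_shape (exprn_gt0 2 eta0) e64.
exists s => // g h gh n.
(* The exponents of [(S, P, Q)] are proportional to [(y, 1, y ^+ 2 - y)], an eigenvector with
   eigenvalue [y] of the map [(r, p, q)] to [(r + q, r, r + p)]. The prefactors absorb the factors
   2. *)
pose P n := 2^-1 * expR (- (L * y ^+ n)).
pose Q n := 2^-1 * expR (- (L * (y ^+ 2 - y) * y ^+ n)).
pose S n := 4^-1 * expR (- (L * y ^+ n.+1)).
have yn0 m : 0 < y ^+ m by apply: exprn_gt0; lra.
have Q_le m : expR (- (L * (y ^+ 2 - y) * y ^+ m)) <= expR (- (L * y ^+ m)).
  rewrite ler_expR lerN2 ler_pM2r // -[leLHS]mulr1 ler_pM2l //; lra.
have S_le m : expR (- (L * y ^+ m.+1)) <= expR (- (L * y ^+ m)).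
  by rewrite ler_expR lerN2 ler_pM2l // exprS ler_peMl // ltW.
have half0 : 0 <= 2^-1 :> R by lra.
have quart0 : 0 <= 4^-1 :> R by lra.
have P0 m : 0 <= P m by rewrite mulr_ge0 ?expR_ge0.
have Q0 m : 0 <= Q m by rewrite mulr_ge0 ?expR_ge0.
have S0 m : 0 <= S m by rewrite mulr_ge0 ?expR_ge0.
have hP m : 2 * S m <= P m.+1 by rewrite /S /P; lra.
have hQ m : 2 * S m * P m <= Q m.+1.
  have -> : 2 * S m * P m = 4^-1 * (expR (- (L * y ^+ m.+1)) * expR (- (L * y ^+ m))).
    by rewrite /S /P; field.
  rewrite -expRD /Q.
  have -> : - (L * y ^+ m.+1) - L * y ^+ m = - (L * (y ^+ 2 - y) * y ^+ m.+1).
    have -> : L * (y ^+ 2 - y) * y ^+ m.+1 = L * (y ^+ 3 - y ^+ 2) * y ^+ m.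
      by rewrite [y ^+ m.+1]exprS; ring.
    by rewrite ey [y ^+ m.+1]exprS; ring.
  by have := expR_ge0 (- (L * (y ^+ 2 - y) * y ^+ m.+1)); lra.
have hS m : 2 * S m * Q m <= S m.+1.
  have -> : 2 * S m * Q m = 4^-1 * (expR (- (L * y ^+ m.+1)) *
      expR (- (L * (y ^+ 2 - y) * y ^+ m))).
    by rewrite /S /Q; field.
  rewrite -expRD /S (_ : - _ - _ = - (L * y ^+ m.+2)) //.
  by rewrite [y ^+ m.+2]exprS [y ^+ m.+1]exprS; ring.
have eta_le (r a : R) : 8^-1 <= r -> a <= y ^+ 2 -> eta <= r * expR (- (L * a)).
  move=> hr ha; apply: ler_pM; rewrite ?expR_ge0 ?invr_ge0 //.
  by rewrite ler_expR lerN2 ler_pM2l.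
have yy : y <= y ^+ 2 by lra.
have coord (a b c : R) : a ^+ 2 + b ^+ 2 + c ^+ 2 <= eta ^+ 2 ->
    [/\ `|a| <= eta, `|b| <= eta & `|c| <= eta].
  move=> habc; have := (sqr_ge0 a, sqr_ge0 b, sqr_ge0 c) => -[[a2 b2] c2].
  by split; rewrite -(ler_pXn2r (isT : 0 < 2)%N) ?nnegrE ?normr_ge0 ?(ltW eta0) //
    real_normK ?num_real //; lra.
have := small g h; rewrite vnorm2E => sm.
have [i0 j0 k0] : [/\ `|qi (seq_eval g h s)| <= eta, `|qj (seq_eval g h s)| <= eta &
    `|qk (seq_eval g h s)| <= eta].
  by move: sm; case: (uq (seq_eval g h s)) => [[[t a] b] c]; exact: coord.
have S00 : eta <= S 0 by apply: eta_le; rewrite ?expr1; lra.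
have P00 : eta <= P 0 by apply: eta_le; rewrite ?expr0; lra.
have Q00 : eta <= Q 0.
  by rewrite /Q -!mulrA; apply: eta_le; rewrite ?expr0 ?mulr1; lra.
have [] := tribonacci_bounds gh fs P0 Q0 S0 hP hQ hS (le_trans i0 S00)
  (le_trans j0 P00) (le_trans k0 Q00) n.
have e0 := expR_ge0 (- (L * y ^+ n)).
have Pb : P n <= expR (- (L * y ^+ n)) by rewrite /P; lra.
have Qb : Q n <= expR (- (L * y ^+ n)).
  apply: le_trans (Q_le n); rewrite /Q.
  by have := expR_ge0 (- (L * (y ^+ 2 - y) * y ^+ n)); lra.
have Sb : S n <= expR (- (L * y ^+ n)).
  by apply: le_trans (S_le n); have := expR_ge0 (- (L * y ^+ n.+1)); rewrite /S; lra.
by move=> hi hj hk; split; [apply: le_trans hi _ | apply: le_trans hj _ |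
  exact: le_trans Qb]; case: ifP.
Qed.

End Tribonacci.

(** * Rotation matrices *)

Section Matrix3.
Variable R : realType.

Definition mx3 (a b c d e f g h i : R) : 'M[R]_3 :=
  \matrix_(k < 3, l < 3) nth 0 [:: a; b; c; d; e; f; g; h; i] (3 * k + l).
Definition cv3 (a b c : R) : 'cV[R]_3 := \col_(k < 3) nth 0 [:: a; b; c] k.

Lemma mx3_eta (M : 'M[R]_3) :
  let o k := inord k : 'I_3 in
  M = mx3 (M (o 0) (o 0)) (M (o 0) (o 1)) (M (o 0) (o 2))
          (M (o 1) (o 0)) (M (o 1) (o 1)) (M (o 1) (o 2))
          (M (o 2) (o 0)) (M (o 2) (o 1)) (M (o 2) (o 2)).
Proof.
move=> o; apply/matrixP => -[[|[|[|//]]] p] [[|[|[|//]]] q]; rewrite mxE /=;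
  by congr (M _ _); apply/val_inj; rewrite /= /o inordK.
Qed.

Lemma cv3_eta (v : 'cV[R]_3) : exists a b c, v = cv3 a b c.
Proof.
pose o k := inord k : 'I_3; exists (v (o 0) 0), (v (o 1) 0), (v (o 2) 0).
apply/matrixP => -[[|[|[|//]]] p] j; rewrite ord1 mxE /=;
  by congr (v _ _); apply/val_inj; rewrite /= /o inordK.
Qed.

Lemma mx3P a b c d e f g h i a' b' c' d' e' f' g' h' i' :
  mx3 a b c d e f g h i = mx3 a' b' c' d' e' f' g' h' i' ->
  [/\ [/\ a = a', b = b' & c = c'], [/\ d = d', e = e' & f = f'] &
      [/\ g = g', h = h' & i = i']].
Proof.
move/matrixP=> E; pose o k := inord k : 'I_3.
have := (E (o 0) (o 0), E (o 0) (o 1), E (o 0) (o 2)).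
have := (E (o 1) (o 0), E (o 1) (o 1), E (o 1) (o 2)).
have := (E (o 2) (o 0), E (o 2) (o 1), E (o 2) (o 2)).
by rewrite !mxE /= /o !inordK //= => -[[-> ->] ->] -[[-> ->] ->] -[[-> ->] ->].
Qed.

Lemma mx3M a b c d e f g h i a' b' c' d' e' f' g' h' i' :
  mx3 a b c d e f g h i *m mx3 a' b' c' d' e' f' g' h' i' =
  mx3 (a * a' + b * d' + c * g') (a * b' + b * e' + c * h') (a * c' + b * f' + c * i')
      (d * a' + e * d' + f * g') (d * b' + e * e' + f * h') (d * c' + e * f' + f * i')
      (g * a' + h * d' + i * g') (g * b' + h * e' + i * h') (g * c' + h * f' + i * i').
Proof.
apply/matrixP => -[[|[|[|//]]] p] [[|[|[|//]]] q]; rewrite !mxE;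
  rewrite !big_ord_recl big_ord0 !mxE /=; ring.
Qed.

Lemma mx3_cv3 a b c d e f g h i x y z :
  mx3 a b c d e f g h i *m cv3 x y z =
  cv3 (a * x + b * y + c * z) (d * x + e * y + f * z) (g * x + h * y + i * z).
Proof.
apply/matrixP => -[[|[|[|//]]] p] j; rewrite !mxE;
  rewrite !big_ord_recl big_ord0 !mxE /=; ring.
Qed.

Lemma mx3T a b c d e f g h i : (mx3 a b c d e f g h i)^T = mx3 a d g b e h c f i.
Proof. by apply/matrixP => -[[|[|[|//]]] p] [[|[|[|//]]] q]; rewrite !mxE. Qed.

Lemma mx3_1 : 1%:M = mx3 1 0 0 0 1 0 0 0 1.
Proof. by apply/matrixP => -[[|[|[|//]]] p] [[|[|[|//]]] q]; rewrite !mxE. Qed.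

Lemma mx3_det a b c d e f g h i : \det (mx3 a b c d e f g h i) =
  a * (e * i - f * h) - b * (d * i - f * g) + c * (d * h - e * g).
Proof.
rewrite (expand_det_row _ ord0) !big_ord_recl big_ord0 !mxE /=.
rewrite /cofactor !(expand_det_row _ ord0) !big_ord_recl !big_ord0 !mxE /=.
rewrite /cofactor !det_mx11 !mxE /=.
ring.
Qed.

End Matrix3.

Section Rotations.
Variable R : realType.
Implicit Types A B O : SO3 R.

(** The matrix of conjugation [v] to [q v (qconj q)] on purely imaginary quaternions. *)
Definition rotmx (q : quat R) : 'M[R]_3 :=
  let: (s, x, y, z) := q in
  mx3 (s ^+ 2 + x ^+ 2 - y ^+ 2 - z ^+ 2) (2 * (x * y - s * z)) (2 * (x * z + s * y))
      (2 * (x * y + s * z)) (s ^+ 2 - x ^+ 2 + y ^+ 2 - z ^+ 2) (2 * (y * z - s * x))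
      (2 * (x * z - s * y)) (2 * (y * z + s * x)) (s ^+ 2 - x ^+ 2 - y ^+ 2 + z ^+ 2).

Lemma mx3_congr (a b c d e f g h i a' b' c' d' e' f' g' h' i' : R) :
  a = a' -> b = b' -> c = c' -> d = d' -> e = e' -> f = f' -> g = g' -> h = h' -> i = i' ->
  mx3 a b c d e f g h i = mx3 a' b' c' d' e' f' g' h' i'.
Proof. by do 9!move->. Qed.

Lemma rotmxM p q : rotmx (qmul p q) = rotmx p *m rotmx q.
Proof.
case: p q => [[[s x] y] z] [[[s' x'] y'] z'] /=.
by rewrite mx3M; apply: mx3_congr; ring.
Qed.

Fact rotation_subproof (q : uquat R) :
  (rotmx q *m (rotmx q)^T == 1%:M) && (\det (rotmx q) == 1).
Proof.
have := uquat_norm q; case: q => [[[[s x] y] z] ?] /= n1.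
rewrite mx3T mx3M mx3_1 mx3_det; apply/andP; split; apply/eqP.
  have n2 : (s ^+ 2 + x ^+ 2 + y ^+ 2 + z ^+ 2) ^+ 2 = 1 by rewrite n1 expr1n.
  by apply: mx3_congr; first [ring | rewrite -[RHS]n2; ring].
have n3 : (s ^+ 2 + x ^+ 2 + y ^+ 2 + z ^+ 2) ^+ 3 = 1 by rewrite n1 expr1n.
by rewrite -[RHS]n3; ring.
Qed.

Definition rotation (q : uquat R) : SO3 R := Rotation (rotation_subproof q).

Lemma rotation_morph : {morph rotation : p q / (p * q)%g}.
Proof. by move=> p q; apply/val_inj; exact: rotmxM. Qed.

(** Each entry equals its cofactor, since the transpose and the adjugate are both inverse to a
    matrix of determinant 1. *)
Lemma so3_mx3 A : exists a b c d e f g h i, [/\ so3_mx A = mx3 a b c d e f g h i,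
  [/\ a * a + b * b + c * c = 1, d * d + e * e + f * f = 1 & g * g + h * h + i * i = 1] &
  [/\ [/\ a = e * i - f * h, b = f * g - d * i & c = d * h - e * g],
      [/\ d = c * h - b * i, e = a * i - c * g & f = b * g - a * h] &
      [/\ g = b * f - c * e, h = c * d - a * f & i = a * e - b * d]]].
Proof.
have [[oT od] Tm] := (so3_mulT A, so3_det A, so3_Tmul A).
have eM := mx3_eta (so3_mx A); rewrite /= in eM; rewrite eM {eM} in oT od Tm *.
move: oT od Tm; move: (so3_mx A (inord 0) (inord 0)) (so3_mx A (inord 0) (inord 1))
 (so3_mx A (inord 0) (inord 2)) (so3_mx A (inord 1) (inord 0)) (so3_mx A (inord 1) (inord 1))
 (so3_mx A (inord 1) (inord 2)) (so3_mx A (inord 2) (inord 0)) (so3_mx A (inord 2) (inord 1))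
 (so3_mx A (inord 2) (inord 2)) => a b c d e f g h i oT od Tm.
exists a, b, c, d, e, f, g, h, i; split=> //.
  by move: oT; rewrite mx3T mx3M mx3_1 => /mx3P[[-> _ _] [_ -> _] [_ _ ->]].
have : mx3 a b c d e f g h i *m
    mx3 (e * i - f * h) (c * h - b * i) (b * f - c * e)
        (f * g - d * i) (a * i - c * g) (c * d - a * f)
        (d * h - e * g) (b * g - a * h) (a * e - b * d) = 1%:M.
  move: od; rewrite mx3_det mx3M mx3_1 => od.
  by apply: mx3_congr; rewrite -?od; ring.
move/(congr1 (mulmx (mx3 a b c d e f g h i)^T)); rewrite mulmxA Tm mul1mx mulmx1 mx3T.
move/mx3P=> [[h1 h2 h3] [h4 h5 h6] [h7 h8 h9]].
split; split; exact: esym.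
Qed.

Definition crossmx (v : 'cV[R]_3) : 'M[R]_3 :=
  let o k := v (inord k) 0 in
  mx3 0 (- o 2) (o 1) (o 2) 0 (- o 0) (- o 1) (o 0) 0.

Lemma crossmx_cv3 x y z : crossmx (cv3 x y z) = mx3 0 (- z) y z 0 (- x) (- y) x 0.
Proof. by rewrite /crossmx !mxE /= !inordK. Qed.

(** The Euler-Rodrigues formula without coordinates, so that a change of frame acts on [v] alone. *)
Definition rotv (s : R) (v : 'cV[R]_3) : 'M[R]_3 :=
  (s ^+ 2 - (v^T *m v) 0 0) *: 1%:M + 2 *: (v *m v^T) + (2 * s) *: crossmx v.

Lemma rotv_cv3 s x y z : rotv s (cv3 x y z) = rotmx (s, x, y, z).
Proof.
rewrite /rotv crossmx_cv3.
apply/matrixP => -[[|[|[|//]]] p] [[|[|[|//]]] q]; rewrite !mxE;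
  rewrite !big_ord_recl !big_ord0 !mxE /=; ring.
Qed.

(** Rotations preserve the cross product; in entries, this is the cofactor relation of [so3_mx3]. *)
Lemma crossmxJ A v : A *m crossmx v *m A^T = crossmx (A *m v).
Proof.
have [a [b [c [d [e [f [g [h [i [-> _ cof]]]]]]]]]] := so3_mx3 A.
have [[ea eb ec] [ed ee ef] [eg eh ei]] := cof.
have [x [y [z ->]]] := cv3_eta v.
rewrite mx3_cv3 !crossmx_cv3 mx3T !mx3M; apply: mx3_congr; try ring.
- rewrite eg eh ei; ring.
- rewrite ed ee ef; ring.
- rewrite eg eh ei; ring.
- rewrite ea eb ec; ring.
- rewrite ed ee ef; ring.
- rewrite ea eb ec; ring.
Qed.

Lemma rotvJ A s v : A *m rotv s v *m A^T = rotv s (A *m v).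
Proof.
rewrite /rotv -crossmxJ trmx_mul.
have -> : v^T *m A^T *m (A *m v) = v^T *m v.
  by rewrite -mulmxA (mulmxA A^T) so3_Tmul mul1mx.
by rewrite !mulmxDr !mulmxDl -!scalemxAr -!scalemxAl mulmx1 so3_mulT !mulmxA.
Qed.

End Rotations.

(** * Rotation axes, half-angles and frames adapted to two conjugate rotations *)

Section Frames.
Variable R : realType.
Implicit Types A B F : SO3 R.

Lemma unit_kernel_vector (M : 'M[R]_3) : \det M = 0 ->
  exists x y z, x ^+ 2 + y ^+ 2 + z ^+ 2 = 1 /\ M *m cv3 x y z = 0.
Proof.
rewrite -det_tr => /eqP/det0P[w w0 wM].
have [a [b [c ew]]] := cv3_eta w^T.
have Mw : M *m cv3 a b c = 0 by rewrite -ew -[M]trmxK -trmx_mul wM trmx0.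
pose n2 := a ^+ 2 + b ^+ 2 + c ^+ 2.
have n20 : 0 < n2.
  rewrite lt_neqAle !addr_ge0 ?sqr_ge0 // andbT eq_sym; apply: contra w0.
  rewrite /n2 !paddr_eq0 ?addr_ge0 ?sqr_ge0 // !sqrf_eq0.
  move=> /andP[/andP[/eqP a0 /eqP b0] /eqP c0].
  rewrite -trmx_eq0 ew a0 b0 c0; apply/eqP/matrixP => -[[|[|[|//]]] p] j; by rewrite !mxE.
pose n := Num.sqrt n2; have nn : n ^+ 2 = n2 by rewrite sqr_sqrtr // ltW.
have n0 : n != 0 by rewrite gt_eqF // sqrtr_gt0.
exists (n^-1 * a), (n^-1 * b), (n^-1 * c); split.
  by rewrite !exprMn -!mulrDr exprVn nn mulVf // gt_eqF.
have -> : cv3 (n^-1 * a) (n^-1 * b) (n^-1 * c) = n^-1 *: cv3 a b c.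
  by apply/matrixP => -[[|[|[|//]]] p] j; rewrite !mxE.
by rewrite -scalemxAr Mw scaler0.
Qed.

Lemma cv3P a b c a' b' c' :
  cv3 a b c = cv3 a' b' c' :> 'cV[R]_3 -> [/\ a = a', b = b' & c = c'].
Proof.
move/matrixP=> E; pose o k := inord k : 'I_3.
have := (E (o 0) 0, E (o 1) 0, E (o 2) 0).
by rewrite !mxE /= /o !inordK //= => -[[-> ->] ->].
Qed.

Lemma cv3_0 : 0 = cv3 0 0 0 :> 'cV[R]_3.
Proof. by apply/matrixP => -[[|[|[|//]]] p] j; rewrite !mxE. Qed.

(** A matrix with rows [u], [v] and 0 is singular, even for dependent [u] and [v]. *)
Lemma unit_orthogonal_vector (u1 u2 u3 v1 v2 v3 : R) : exists x y z,
  [/\ x ^+ 2 + y ^+ 2 + z ^+ 2 = 1, u1 * x + u2 * y + u3 * z = 0 &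
      v1 * x + v2 * y + v3 * z = 0].
Proof.
have [|x [y [z [n1]]]] := @unit_kernel_vector (mx3 u1 u2 u3 v1 v2 v3 0 0 0).
  by rewrite mx3_det; ring.
by rewrite mx3_cv3 cv3_0 => /cv3P[h1 h2 _]; exists x, y, z.
Qed.

(** From [A - 1 = A (1 - A^T)] and odd dimension, [\det (A - 1)] equals its own negative. *)
Lemma so3_fixed_unit_vector A : exists x y z,
  x ^+ 2 + y ^+ 2 + z ^+ 2 = 1 /\ A *m cv3 x y z = cv3 x y z.
Proof.
have [|x [y [z [n1 h]]]] := @unit_kernel_vector (so3_mx A - 1%:M).
  have e : \det (so3_mx A - 1%:M) = - \det (so3_mx A - 1%:M).
    rewrite -{1}(so3_mulT A) -{1}[so3_mx A]mulmx1 -mulmxBr det_mulmx so3_det mul1r.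
    rewrite -[LHS]det_tr linearB /= trmxK trmx1 -opprB -scaleN1r detZ.
    by rewrite -signr_odd /= expr1 mulN1r.
  lra.
exists x, y, z; split=> //.
by apply/eqP; rewrite -subr_eq0 -[X in _ - X]mul1mx -mulmxBl h.
Qed.

(** The middle row is the cross product of [f] and [e], a unit vector by Lagrange's identity. *)
Lemma exists_frame (e1 e2 e3 f1 f2 f3 : R) :
  e1 ^+ 2 + e2 ^+ 2 + e3 ^+ 2 = 1 -> f1 ^+ 2 + f2 ^+ 2 + f3 ^+ 2 = 1 ->
  e1 * f1 + e2 * f2 + e3 * f3 = 0 ->
  exists F, so3_mx F = mx3 e1 e2 e3
    (f2 * e3 - f3 * e2) (f3 * e1 - f1 * e3) (f1 * e2 - f2 * e1) f1 f2 f3.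
Proof.
move=> ne nf ef; pose M := mx3 e1 e2 e3
    (f2 * e3 - f3 * e2) (f3 * e1 - f1 * e3) (f1 * e2 - f2 * e1) f1 f2 f3.
have nn : (e1 ^+ 2 + e2 ^+ 2 + e3 ^+ 2) * (f1 ^+ 2 + f2 ^+ 2 + f3 ^+ 2)
    - (e1 * f1 + e2 * f2 + e3 * f3) ^+ 2 = 1 by rewrite ne nf ef; ring.
have MP : (M *m M^T == 1%:M) && (\det M == 1).
  rewrite mx3T mx3M mx3_det mx3_1; apply/andP; split; apply/eqP; last first.
    by rewrite -[RHS]nn; ring.
  apply: mx3_congr; try ring.
  - by rewrite -[RHS]ne; ring.
  - by rewrite -[RHS]ef; ring.
  - by rewrite -[RHS]nn; ring.
  - by rewrite -[RHS]ef; ring.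
  - by rewrite -[RHS]nf; ring.
by exists (Rotation MP).
Qed.

(** [s] and [t] are cosine and sine of half the angle. The case [a = -1] is apart because [t] is
    found by dividing by [s]. *)
Lemma half_angle (a b : R) : a ^+ 2 + b ^+ 2 = 1 ->
  exists s t, [/\ s ^+ 2 + t ^+ 2 = 1, s ^+ 2 - t ^+ 2 = a & 2 * s * t = b].
Proof.
move=> ab; have [a1|a1] := eqVneq a (-1).
  have b0 : b = 0 by apply/eqP; rewrite -sqrf_eq0; apply/eqP; move: ab; rewrite a1; lra.
  by exists 0, 1; rewrite a1 b0; split; ring.
have a0 : 0 < (1 + a) / 2.
  rewrite divr_gt0 // lt_neqAle eq_sym addrC addr_eq0 a1 /=.
  have : `|a| <= 1.
    rewrite -(ler_pXn2r (isT : 0 < 2)%N) ?nnegrE ?normr_ge0 // real_normK ?num_real //.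
    by rewrite expr1n; have := sqr_ge0 b; lra.
  by move/ler_normlP => -[]; lra.
pose s := Num.sqrt ((1 + a) / 2).
have s2 : s ^+ 2 = (1 + a) / 2 by rewrite sqr_sqrtr // ltW.
have s0 : s != 0 by rewrite gt_eqF // sqrtr_gt0.
have t2 : (b / (2 * s)) ^+ 2 = (1 - a) / 2.
  have a1' : 1 + a != 0 by lra.
  rewrite expr_div_n exprMn s2 (_ : b ^+ 2 = (1 - a) * (1 + a)); last by lra.
  by field.
by exists s, (b / (2 * s)); rewrite s2 t2; split; [field | field | field].
Qed.

(** Euler's theorem: in a frame whose third vector is fixed by [A], the matrix is a plane rotation,
    and [half_angle] yields its quaternion. *)
Lemma so3_rotv A : exists s t x y z, [/\ s ^+ 2 + t ^+ 2 = 1,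
  x ^+ 2 + y ^+ 2 + z ^+ 2 = 1 & so3_mx A = rotv s (t *: cv3 x y z)].
Proof.
have [x [y [z [nu Au]]]] := so3_fixed_unit_vector A.
have [e1 [e2 [e3 [ne eu _]]]] := unit_orthogonal_vector x y z 0 0 0.
have [|F FE] := exists_frame ne nu; first by rewrite -eu; ring.
have FTe : F^T *m cv3 0 0 1 = cv3 x y z.
  by rewrite FE mx3T mx3_cv3; congr cv3; ring.
have Fu : F *m cv3 x y z = cv3 0 0 1 by rewrite -FTe mulmxA so3_mulT mul1mx.
pose M := (F * A * F^-1)%g.
have ME : so3_mx M = F *m A *m F^T by [].
have : so3_mx M *m cv3 0 0 1 = cv3 0 0 1 by rewrite ME -!mulmxA FTe Au Fu.
have [a [b [c [d [e [f [g [h [i [Mabc [r1 _ _] [[ea eb _] _ [eg eh _]]]]]]]]]]]] := so3_mx3 M.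
rewrite Mabc mx3_cv3 => /cv3P[c0 f0 i1].
have {}c0 : c = 0 by lra. have {}f0 : f = 0 by lra. have {}i1 : i = 1 by lra.
rewrite c0 f0 i1 in Mabc r1 ea eb eg eh *.
(* The cofactor relations force the remaining entries. *)
have g0 : g = 0 by lra. have h0 : h = 0 by lra.
have {}ea : e = a by lra. have {}eb : d = - b by lra.
have [|s [t [st sa sb]]] := @half_angle a (- b); first by rewrite -r1; ring.
exists s, t, x, y, z; split=> //.
have MR : so3_mx M = rotv s (cv3 0 0 t).
  by rewrite rotv_cv3 Mabc; apply: mx3_congr; rewrite ?g0 ?h0 ?ea ?eb; lra.
have -> : so3_mx A = F^T *m so3_mx M *m F by
  rewrite ME !mulmxA so3_Tmul mul1mx -mulmxA so3_Tmul mulmx1.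
have /= := rotvJ (F^-1)%g s (cv3 0 0 t); rewrite trmxK -MR => ->; congr rotv.
by rewrite -FTe scalemxAr; congr (_ *m _); apply/matrixP => -[[|[|[|//]]] p] j;
  rewrite !mxE /= ?mulr0 ?mulr1.
Qed.

(** The first row [e] is orthogonal to [u] and [v], and the third row [f] is their normalised
    bisector. *)
Lemma exists_bisecting_frame (u1 u2 u3 v1 v2 v3 : R) :
  u1 ^+ 2 + u2 ^+ 2 + u3 ^+ 2 = 1 -> v1 ^+ 2 + v2 ^+ 2 + v3 ^+ 2 = 1 ->
  exists F c d, [/\ c ^+ 2 + d ^+ 2 = 1, F *m cv3 u1 u2 u3 = cv3 0 c d &
    F *m cv3 v1 v2 v3 = cv3 0 (- c) d].
Proof.
move=> nu nv.
have [e1 [e2 [e3 [ne eu ev]]]] := unit_orthogonal_vector u1 u2 u3 v1 v2 v3.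
suff [f1 [f2 [f3 [nf ef huv hperp]]]] : exists f1 f2 f3,
    [/\ f1 ^+ 2 + f2 ^+ 2 + f3 ^+ 2 = 1, e1 * f1 + e2 * f2 + e3 * f3 = 0,
      f1 * u1 + f2 * u2 + f3 * u3 = f1 * v1 + f2 * v2 + f3 * v3 &
      (f2 * e3 - f3 * e2) * (u1 + v1) + (f3 * e1 - f1 * e3) * (u2 + v2) +
      (f1 * e2 - f2 * e1) * (u3 + v3) = 0].
  have [F FE] := exists_frame ne nf ef.
  exists F, ((f2 * e3 - f3 * e2) * u1 + (f3 * e1 - f1 * e3) * u2 + (f1 * e2 - f2 * e1) * u3),
    (f1 * u1 + f2 * u2 + f3 * u3).
  have Fu : F *m cv3 u1 u2 u3 = cv3 0
     ((f2 * e3 - f3 * e2) * u1 + (f3 * e1 - f1 * e3) * u2 + (f1 * e2 - f2 * e1) * u3)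
     (f1 * u1 + f2 * u2 + f3 * u3).
    by rewrite FE mx3_cv3; congr cv3; rewrite -[RHS]eu; ring.
  split=> //; last first.
    rewrite FE mx3_cv3; congr cv3; last by rewrite huv.
      by rewrite -[RHS]ev; ring.
    by move: hperp; lra.
  have := congr1 (fun v => (v^T *m v) 0 0) Fu.
  rewrite trmx_mul -mulmxA (mulmxA F^T) so3_Tmul mul1mx !mxE !big_ord_recl !big_ord0 !mxE /=.
  by move=> E; lra.
pose n2 := (u1 + v1) ^+ 2 + (u2 + v2) ^+ 2 + (u3 + v3) ^+ 2.
(* For [v = - u] there is no bisector, and any unit vector orthogonal to [e] and [u] serves. *)
have [n20|n20] := eqVneq n2 0.
  have [f1 [f2 [f3 [nf fe fu]]]] := unit_orthogonal_vector e1 e2 e3 u1 u2 u3.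
  have := n20; rewrite /n2 => /eqP; rewrite !paddr_eq0 ?addr_ge0 ?sqr_ge0 //.
  rewrite !sqrf_eq0 => /andP[/andP[/eqP h1 /eqP h2] /eqP h3].
  exists f1, f2, f3; split=> //; last by rewrite h1 h2 h3; ring.
  have -> : v1 = - u1 by lra. have -> : v2 = - u2 by lra. have -> : v3 = - u3 by lra.
  by lra.
have n2p : 0 < n2 by rewrite lt_neqAle eq_sym n20 !addr_ge0 ?sqr_ge0.
pose n := Num.sqrt n2; have nn : n ^+ 2 = n2 by rewrite sqr_sqrtr // ltW.
have n0 : n != 0 by rewrite gt_eqF // sqrtr_gt0.
exists ((u1 + v1) / n), ((u2 + v2) / n), ((u3 + v3) / n); split.
- by rewrite !expr_div_n -!mulrDl nn divff.
- have -> : e1 * ((u1 + v1) / n) + e2 * ((u2 + v2) / n) + e3 * ((u3 + v3) / n) =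
    ((u1 * e1 + u2 * e2 + u3 * e3) + (v1 * e1 + v2 * e2 + v3 * e3)) / n by field.
  by rewrite eu ev addr0 mul0r.
- apply/eqP; rewrite -subr_eq0; apply/eqP.
  transitivity (((u1 ^+ 2 + u2 ^+ 2 + u3 ^+ 2) - (v1 ^+ 2 + v2 ^+ 2 + v3 ^+ 2)) / n).
    by field.
  by rewrite nu nv subrr mul0r.
- by field.
Qed.

(** By [rotvJ] both rotations have the same angle, and their axes are [u] and [B u]; the frame is
    the bisecting one of these axes. *)
Lemma conjugate_rotations_normal_form A B : exists F g h,
  [/\ symmetric_pair g h, A = (F^-1 * rotation g * F)%g &
      (B * A * B^-1 = F^-1 * rotation h * F)%g].
Proof.
have [s [t [u1 [u2 [u3 [st nu AE]]]]]] := so3_rotv A.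
have [v1 [v2 [v3 vE]]] := cv3_eta (B *m cv3 u1 u2 u3).
have nv : v1 ^+ 2 + v2 ^+ 2 + v3 ^+ 2 = 1.
  have := congr1 (fun v => (v^T *m v) 0 0) vE.
  rewrite trmx_mul -mulmxA (mulmxA B^T) so3_Tmul mul1mx !mxE !big_ord_recl !big_ord0 !mxE /=.
  by move=> E; lra.
have [F [c [d [cd Fu Fv]]]] := exists_bisecting_frame nu nv.
have scd c' : c' ^+ 2 = c ^+ 2 -> qnorm2 (s, 0, t * c', t * d) == 1.
  move=> ec; apply/eqP => /=; rewrite -st !exprMn ec.
  by transitivity (s ^+ 2 + t ^+ 2 * (c ^+ 2 + d ^+ 2)); [ring | rewrite cd mulr1].
exists F, (UQuat (scd c erefl)), (UQuat (scd (- c) (sqrrN c))); split.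
- by exists s, (t * c), (t * d); rewrite /= mulrN.
- suff <- : (F * A * F^-1 = rotation (UQuat (scd c erefl)))%g.
    by rewrite !mulgA mulVg mul1g mulgVK.
  apply/val_inj; rewrite -[RHS]/(rotmx (s, 0, _, _)) -rotv_cv3.
  rewrite -[LHS]/(F *m A *m F^T) AE rotvJ -scalemxAr Fu; congr rotv.
  by apply/matrixP => -[[|[|[|//]]] p] j; rewrite !mxE /= ?mulr0.
- suff <- : (F * (B * A * B^-1) * F^-1 = rotation (UQuat (scd (- c)%R (sqrrN c))))%g.
    by rewrite !mulgA mulVg mul1g mulgVK.
  apply/val_inj; rewrite -[RHS]/(rotmx (s, 0, _, _)) -rotv_cv3.
  rewrite -[LHS]/(F *m (B *m A *m B^T) *m F^T) AE !rotvJ -!scalemxAr vE Fv; congr rotv.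
  by apply/matrixP => -[[|[|[|//]]] p] j; rewrite !mxE /= ?mulr0.
Qed.

End Frames.

(** * Words in [a] and [b a b^-1], and operator norms *)

(* The reduced form of the image of a reduced word under [a -> a],
   [b -> b a b^-1]; the flag tells whether a letter [b] is still to be closed. *)
Fixpoint conj_word (c : bool) (s : seq letter) : seq letter :=
  if s is x :: s' then
    (if c == x.1 then [::] else [:: (true, c)]) ++ (false, x.2) :: conj_word x.1 s'
  else if c then [:: lb'] else [::].

Lemma conj_word_reduced s : reduced s -> reduced (conj_word false s).
Proof.
have main x s' : reduced (x :: s') -> reduced ((false, x.2) :: conj_word x.1 s').
  elim: s' x => [|y s' IH] x; first by case: x => [[] []].
  move=> /[dup] /reduced_tail/IH; rewrite /reduced /= => h /andP[yx _].
  case: x y yx h => [[] x2] [[] y2] /=; rewrite ?andbT // => yx h.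
  - by rewrite h andbT.
  - by rewrite h andbT.
case: s => // -[[] x2] s' /main //.
Qed.

Lemma size_conj_word c s : (size (conj_word c s) <= 2 * size s + 1)%N.
Proof.
elim: s c => [|x s IH] c /=; first by case: c.
rewrite size_cat /= mulnS addnS -addSn -addnA; apply: leq_add => //.
by case: ifP.
Qed.

Lemma conj_word_neq0 s : s != [::] -> conj_word false s != [::].
Proof. by case: s => // -[[] x] s. Qed.

Lemma seq_eval_conj_word (G : groupType) (g h : G) s :
  seq_eval g h (conj_word false s) = seq_eval g (h * g * h^-1)%g s.
Proof.
(* When the flag is set, a letter [b] already written stands to the left of the remaining word. *)
have main c : ((if c then h else 1) * seq_eval g h (conj_word c s) =
    seq_eval g (h * g * h^-1) s)%g.
  elim: s c => [|[x1 x2] s IH] c /=.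
    by case: c; rewrite /letter_eval /= ?mulg1 ?mulgV.
  rewrite -(IH x1) seq_eval_cat /=.
  by case: x1 x2 c {IH} => [] [] []; rewrite /letter_eval /= ?invgM ?invgK ?mul1g ?mulg1 ?mulgA
    ?mulgV ?mulVg ?mul1g ?mulgVK ?mulgK.
by rewrite -(main false) mul1g.
Qed.

(** * Operator norms bounded through matrix entries *)

Section OperatorNorm.
Variable R : realType.

Lemma mulmx_entry_le m n p (A : 'M[R]_(m, n)) (B : 'M[R]_(n, p)) (a b : R) :
  0 <= a -> (forall i j, `|A i j| <= a) -> (forall i j, `|B i j| <= b) ->
  forall i j, `|(A *m B) i j| <= n%:R * (a * b).
Proof.
move=> a0 hA hB i j; rewrite mxE; apply: le_trans (ler_norm_sum _ _ _) _.
rewrite mulr_natl -[in leRHS](card_ord n) -sumr_const; apply: ler_sum => k _.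
by rewrite normrM; apply: ler_pM.
Qed.

Lemma enorm_le n (v : 'cV[R]_n) : enorm v <= \sum_i `|v i 0|.
Proof.
have S0 : 0 <= \sum_i `|v i 0| by apply: sumr_ge0.
rewrite /enorm -(ler_pXn2r (isT : 0 < 2)%N) ?nnegrE ?sqrtr_ge0 //.
rewrite sqr_sqrtr ?sumr_ge0 // => [|i _]; last exact: sqr_ge0.
rewrite expr2 mulr_suml; apply: ler_sum => i _.
rewrite -real_normK ?num_real // expr2 ler_wpM2l //.
by rewrite (bigD1 i) //= lerDl sumr_ge0.
Qed.

Lemma entry_le_enorm n (v : 'cV[R]_n) i : `|v i 0| <= enorm v.
Proof.
rewrite /enorm -(ler_pXn2r (isT : 0 < 2)%N) ?nnegrE ?sqrtr_ge0 //.
rewrite sqr_sqrtr ?sumr_ge0 // => [|k _]; last exact: sqr_ge0.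
by rewrite real_normK ?num_real // (bigD1 i) //= lerDl sumr_ge0 // => k _; rewrite sqr_ge0.
Qed.

Lemma opnorm_le n (M : 'M[R]_n) (m : R) : 0 <= m -> (forall i j, `|M i j| <= m) ->
  opnorm M <= n%:R ^+ 2 * m.
Proof.
move=> m0 hM; apply: ge_sup.
  exists (enorm (M *m 0)), 0 => //=.
  by rewrite /enorm big1 ?sqrtr0 // => i _; rewrite mxE expr0n.
move=> _ [v /= v1 <-]; apply: le_trans (enorm_le _) _.
have hv i j : `|v i j| <= 1 by rewrite ord1; exact: le_trans (entry_le_enorm _ _) v1.
rewrite expr2 -mulrA mulr_natl -[in leRHS](card_ord n) -sumr_const; apply: ler_sum => k _.
by apply: le_trans (mulmx_entry_le m0 hM hv k 0) _; rewrite mulr1 card_ord.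
Qed.

Lemma so3_entry_le1 (A : SO3 R) i j : `|A i j| <= 1.
Proof.
rewrite -(ler_pXn2r (isT : 0 < 2)%N) ?nnegrE // expr1n real_normK ?num_real //.
have /matrixP/(_ i i) := so3_mulT A; rewrite !mxE eqxx mulr1n => <-.
rewrite (bigD1 j) //= mxE -expr2 lerDl sumr_ge0 // => k _.
by rewrite mxE -expr2 sqr_ge0.
Qed.

(** Unit norm turns the diagonal entries into [- 2 * (y ^+ 2 + z ^+ 2)] and the like. No sign of the
    real part is needed, as [q] and [- q] give the same rotation. *)
Lemma rotmx_sub1_entry_le (q : uquat R) (m : R) : m <= 1 ->
  `|qi q| <= m -> `|qj q| <= m -> `|qk q| <= m ->
  forall i j, `|(rotmx q - 1%:M) i j| <= 4 * m.
Proof.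
move=> m1; have := uquat_re_le1 q; have := uquat_norm q.
case: q => [[[[s x] y] z] ?]; rewrite /qre /qi /qj /qk /= => n1 hs hx hy hz.
have m0 : 0 <= m by exact: le_trans hx.
have diag a b : `|a| <= m -> `|b| <= m -> `|2 * (a ^+ 2 + b ^+ 2)| <= 4 * m.
  move=> ha hb; rewrite ger0_norm ?mulr_ge0 ?addr_ge0 ?sqr_ge0 //.
  have sq c : `|c| <= m -> c ^+ 2 <= m.
    move=> hc; rewrite -real_normK ?num_real // expr2 -[leRHS]mulr1.
    by apply: ler_pM => //; exact: le_trans m1.
  by have := (sq a ha, sq b hb) => -[]; lra.
have off a b c : `|a| <= m -> `|b| <= m -> `|c| <= m -> `|2 * (a * b + s * c)| <= 4 * m.
  move=> ha hb hc; rewrite normrM ger0_norm // (_ : 4 = 2 * 2) -?mulrA ?ler_pM2l //;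
    last by ring.
  apply: le_trans (ler_normD _ _) _; rewrite !normrM mulr_natl mulr2n lerD //.
    by rewrite -[leRHS]mulr1; apply: ler_pM => //; exact: le_trans m1.
  by rewrite -[leRHS]mul1r; apply: ler_pM.
have off' a b c : `|a| <= m -> `|b| <= m -> `|c| <= m -> `|2 * (a * b - s * c)| <= 4 * m.
  by move=> ha hb hc; rewrite -mulrN; apply: off; rewrite ?normrN.
rewrite mx3_1 => -[[|[|[|//]]] p] [[|[|[|//]]] q]; rewrite !mxE /= ?subr0.
all: try by [apply: off | apply: off'].
- rewrite (_ : _ - _ = - (2 * (y ^+ 2 + z ^+ 2))); [by rewrite normrN diag | lra].
- rewrite (_ : _ - _ = - (2 * (x ^+ 2 + z ^+ 2))); [by rewrite normrN diag | lra].
- rewrite (_ : _ - _ = - (2 * (x ^+ 2 + y ^+ 2))); [by rewrite normrN diag | lra].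
Qed.

Lemma opnorm_conj_rotation_le (F : SO3 R) (q : uquat R) (m : R) : m <= 1 ->
  `|qi q| <= m -> `|qj q| <= m -> `|qk q| <= m ->
  opnorm (so3_mx (F^-1 * rotation q * F)%g - 1%:M) <= 324 * m.
Proof.
move=> m1 hi hj hk; have m0 : 0 <= m by exact: le_trans hi.
have -> : so3_mx (F^-1 * rotation q * F)%g - 1%:M = F^T *m (rotmx q - 1%:M) *m F.
  by rewrite mulmxBr mulmxBl mulmx1 so3_Tmul.
have FT i j : `|F^T i j| <= 1 by rewrite mxE; exact: so3_entry_le1.
(* The constant 324 is 4 from the entries, 3 from each of two matrix products, and 9 from
   [opnorm_le]. *)
have h1 := mulmx_entry_le ler01 FT (rotmx_sub1_entry_le m1 hi hj hk).
have h10 : 0 <= 3 * (1 * (4 * m)) by lra.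
have h2 := mulmx_entry_le h10 h1 (so3_entry_le1 F).
apply: le_trans (opnorm_le _ h2) _; lra.
Qed.

End OperatorNorm.

(** * Almost laws for SO(3) and their lengths *)

Lemma exists_almost_law_words (R : realType) (y : R) : 1 < y ->
  y ^+ 3 = y ^+ 2 + y + 1 ->
  exists (C : R) (W : nat -> F2), [/\ 0 < C, forall n, W n <> 1%g,
    forall n, (word_length (W n))%:R <= C * 2 ^+ n &
    forall n (A B : SO3 R),
      opnorm (so3_mx (word_eval A B (W n)) - 1%:M) <= expR (- y ^+ n)].
Proof.
(* As [1 <= y ^+ n], this [L] makes [324 * expR (- (L * y ^+ n))] at most [expR (- y ^+ n)]. *)
move=> y1 ey; pose L : R := ln 324 + 1.
have L1 : 1 < L by rewrite ltrDr ln_gt0 // ltr1n.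
have [s fs small] := @exists_tribonacci_words R L y (lt_trans ltr01 L1) y1 ey.
have shape n : exists t, doubling_shape t (tribonacci_word s n).
  exact: tribonacci_word_shape.
have red n : reduced (tribonacci_word s n) by have [t []] := shape n.
pose W n := FreeWord (conj_word_reduced (red n)).
exists (3 * (size s)%:R), W; split.
- by case: fs => _ [m ->]; rewrite mulr_gt0 // ltr0n.
- move=> n /(congr1 fword) /eqP; apply/negP; apply: conj_word_neq0.
  by have [t [_ [m ->]]] := shape n.
- move=> n; rewrite /word_length /=.
  have h : (size (conj_word false (tribonacci_word s n)) <= 3 * size s * 2 ^ n)%N.
    apply: leq_trans (size_conj_word _ _) _.
    have hs : (0 < 2 ^ n * size s)%N by case: fs => _ [m ->]; rewrite muln_gt0 expn_gt0.
    have := size_tribonacci_word s n => hn.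
    rewrite -mulnA (mulnC (size s)) (_ : 3 = 2 + 1)%N // mulnDl mul1n.
    by rewrite leq_add // leq_mul2l hn.
  by rewrite -natrX -!natrM ler_nat.
move=> n A B.
have [F [g [h [gh eA eB]]]] := conjugate_rotations_normal_form A B.
have -> : word_eval A B (W n) = (F^-1 * rotation (seq_eval g h (tribonacci_word s n)) * F)%g.
  rewrite -[LHS]/(seq_eval A B (conj_word false (tribonacci_word s n))).
  rewrite seq_eval_conj_word eB [in seq_eval A _]eA.
  rewrite (@seq_eval_morph _ _ (fun q => F^-1 * rotation q * F)%g) // => p q.
  by rewrite rotation_morph !mulgA mulgK.
have [hi hj hk] := small g h gh n.
have yn1 : 1 <= y ^+ n by rewrite exprn_ege1 // ltW.
apply: le_trans (opnorm_conj_rotation_le _ _ hi hj hk) _.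
  by rewrite -expR0 ler_expR oppr_le0 mulr_ge0 //; lra.
rewrite -[X in X * _](@lnK R) ?posrE // -expRD ler_expR.
have ln0 : 0 <= ln (324 : R) by rewrite ln_ge0 // ler1n.
have : ln 324 * 1 <= ln (324 : R) * y ^+ n by rewrite ler_wpM2l.
by rewrite /L mulrDl mul1r; lra.
Qed.

Theorem theorem1p1 (R : realType) (x0 delta : R)
  (hx0 : 1 < x0) (hroot : x0 ^+ 3 = x0 ^+ 2 + x0 + 1)
  (hdelta : delta = ln x0 / ln 2) :
  (exists (c C : R) (W : nat -> F2),
    [/\ 0 < c, 0 < C,
        forall n : nat, W n <> 1%g,
        forall n : nat, (word_length (W n))%:R <= C * 2 ^+ n
      & forall (n : nat) (A B : SO3 R),
          opnorm (so3_mx (word_eval A B (W n)) - 1%:M)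
            <= expR (- (c * (word_length (W n))%:R `^ delta))])
  /\
  (exists (C' eps0 : R),
    [/\ 0 < C', 0 < eps0, eps0 < 1
      & forall eps : R, 0 < eps -> eps <= eps0 ->
          (almost_law_length eps <= (C' * ln (1 / eps) `^ (1 / delta))%:E)%E]).
Proof.
have [C [W [C0 W1 WC WA]]] := exists_almost_law_words hx0 hroot.
have ln2 : 0 < ln (2 : R) by rewrite ln_gt0 // ltr1n.
have lnx0 : 0 < ln x0 by rewrite ln_gt0.
have delta0 : 0 < delta by rewrite hdelta divr_gt0.
have delta0' : 0 <= 1 / delta by rewrite divr_ge0 // ltW.
have x00 : 0 < x0 by lra.
(* By definition of [delta], [x0] is 2 to the power [delta]. *)
have pow2 n : (2 ^+ n) `^ delta = x0 ^+ n.
  rewrite -powR_mulrn // -powRrM mulrC powRrM hdelta -[in RHS](@lnK R x0) ?posrE //.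
  rewrite -powR_mulrn ?expR_ge0 //; congr (_ `^ _).
  by rewrite /powR pnatr_eq0 /= divfK // gt_eqF.
split.
  (* The length bound raised to the power [delta] reads at most [C] to the [delta] times
     [x0 ^+ n]. *)
  exists (C `^ delta)^-1, C, W; split=> //; first by rewrite invr_gt0 powR_gt0.
  move=> n A B; apply: le_trans (WA n A B) _; rewrite ler_expR lerN2.
  rewrite mulrC ler_pdivrMr ?powR_gt0 // -pow2 mulrC -powRM ?(ltW C0) ?exprn_ge0 //.
  by apply: ge0_ler_powR; rewrite ?nnegrE ?mulr_ge0 ?exprn_ge0 ?(ltW C0) ?(ltW delta0).
(* The choice of [eps0] ensures [1 <= T]. The factor 2 pays for rounding [n] up: minimality of [n]
   controls only [x0 ^+ n.-1]. *)
exists (2 * C), (expR (-1)); split; rewrite ?expR_gt0 ?mulr_gt0 //.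
move=> eps e0 e1; set T := ln (1 / eps).
have eT : eps = expR (- T) by rewrite /T div1r lnV ?posrE // opprK lnK.
have T1 : 1 <= T by move: e1; rewrite eT ler_expR; lra.
have exn : exists n, T <= x0 ^+ n.
  exists (Num.truncn (T / ln x0)).+1.
  have h := truncnS_gt (T / ln x0); rewrite ltr_pdivrMr // in h.
  rewrite -[X in X ^+ _](@lnK R) ?posrE // -expRM_natl.
  apply: le_trans (expR_ge1Dx _); lra.
case: (ex_minnP exn) => n Tn nmin.
have alaw : almost_law eps (W n).
  split=> // A B; apply: le_trans (WA n A B) _.
  by rewrite eT ler_expR lerN2.
apply: (@le_trans _ _ ((word_length (W n))%:R%:E)).
  by apply: ereal_inf_lbound; exists (W n).
rewrite lee_fin; apply: le_trans (WC n) _.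
rewrite (mulrC 2) -mulrA ler_pM2l //.
(* For [n = 0] there is no predecessor, and [1 <= T] gives the bound. *)
case: n Tn nmin {alaw} => [|n] Tn nmin.
  have : 1 <= T `^ (1 / delta).
    rewrite -[leLHS]/((fun=> 1) (1 / delta)) -powR1.
    by apply: ge0_ler_powR; rewrite ?nnegrE; lra.
  by rewrite expr0; lra.
have xT : x0 ^+ n < T by rewrite ltNge; apply/negP => /nmin; rewrite ltnn.
rewrite exprS ler_pM2l //.
have -> : 2 ^+ n = (x0 ^+ n) `^ (1 / delta) :> R.
  by rewrite -pow2 -powRrM div1r mulfV ?gt_eqF // powRr1 // exprn_ge0.
by apply: ge0_ler_powR; rewrite ?nnegrE ?exprn_ge0 ?(ltW x00) //; lra.
Qed.
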